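(* Assume that $\mu \colon \mathcal{P}^2_o \to \mathbb{R}^{2\times 2}$ is a measurable valuation which is $\mathrm{GL}(2)$-contravariant, i.e. $\mu(\phi P) = |\det\phi|^{-1}\,\phi^{-t}\,\mu(P)\,\phi^{-1}$ for all $P \in \mathcal{P}^2_o$ and all $\phi \in \mathrm{GL}(2)$. Then there exists $k \in \mathbb{R}$ such that $\mu(P) = k\, M_2(P^* )$ for all $P \in \mathcal{P}^2_o$.
   Context: $\mathcal{P}^2_o$ denotes the set of convex polygons in $\mathbb{R}^2$ containing the origin in their interiors, with the Hausdorff metric topology; ''measurable'' refers to Borel $\sigma$-algebras. $\phi^{-t}$ is the inverse of the transpose of $\phi$. A map $\mu$ on a family $\mathcal{S}$ of sets is a valuation if $\mu(K \cup L) + \mu(K \cap L) = \mu(K) + \mu(L)$ whenever $K, L, K\cup L, K \cap L \in \mathcal{S}$. The moment matrix is $M_2(P) = \int_P x\,x^t\,dx$ and $P^* = \{y : y^t x \le 1 \ \forall x \in P\}$ is the polar body. *)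

(* Defs.v *)
From HB Require Import structures.
From mathcomp Require Import all_boot all_order all_algebra.
From mathcomp Require Import all_classical all_reals all_analysis.
Set Implicit Arguments. Unset Strict Implicit. Unset Printing Implicit Defensive.
Import Order.TTheory GRing.Theory Num.Theory.
Import numFieldNormedType.Exports.
Local Open Scope classical_set_scope.
Local Open Scope ring_scope.

Definition enorm (R : realType) (x : 'cV[R]_2) : R :=
  Num.sqrt (x ord0 ord0 ^+ 2 + x (lift ord0 ord0) ord0 ^+ 2).

Definition pt2 (R : realType) (a b : R) : 'cV[R]_2 :=
  \col_(i < 2) (if i == ord0 then a else b).

Definition conv_hull (R : realType) (s : seq 'cV[R]_2) : set 'cV[R]_2 :=
  [set x | exists w : 'I_(size s) -> R,
     (forall i, 0 <= w i) /\ \sum_(i < size s) w i = 1 /\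
     x = \sum_(i < size s) w i *: s`_i].

Definition polyo (R : realType) : set (set 'cV[R]_2) :=
  [set P | (exists s : seq 'cV[R]_2, P = conv_hull s) /\
           exists e : R, 0 < e /\ forall x, enorm x < e -> P x].

Definition dist_pt (R : realType) (x : 'cV[R]_2) (L : set 'cV[R]_2) : R :=
  inf [set enorm (x - y) | y in L].

Definition hdist (R : realType) (K L : set 'cV[R]_2) : R :=
  Num.max (sup [set dist_pt x L | x in K]) (sup [set dist_pt y K | y in L]).

Definition hopen (R : realType) (S : set (set 'cV[R]_2)) : Prop :=
  S `<=` @polyo R /\
  forall P, S P -> exists e : R, 0 < e /\
    forall Q, @polyo R Q -> hdist P Q < e -> S Q.

Definition hborel (R : realType) : set (set (set 'cV[R]_2)) :=
  <<s @polyo R, @hopen R >>.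

Definition measurable_on_polyo (R : realType)
  (mu : set 'cV[R]_2 -> 'M[R]_2) : Prop :=
  forall U : set 'M[R]_2, open U -> @hborel R (@polyo R `&` mu @^-1` U).

Definition valuation_on_polyo (R : realType)
  (mu : set 'cV[R]_2 -> 'M[R]_2) : Prop :=
  forall K L, @polyo R K -> @polyo R L -> @polyo R (K `|` L) -> @polyo R (K `&` L) ->
    mu (K `|` L) + mu (K `&` L) = mu K + mu L.

Definition GL2_contravariant (R : realType)
  (mu : set 'cV[R]_2 -> 'M[R]_2) : Prop :=
  forall (phi : 'M[R]_2) P, phi \in unitmx -> @polyo R P ->
    mu ((fun x => phi *m x) @` P) =
    `|\det phi|^-1 *: ((invmx phi)^T *m mu P *m invmx phi).

Definition polar (R : realType) (P : set 'cV[R]_2) : set 'cV[R]_2 :=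
  [set y | forall x, P x -> (y^T *m x) ord0 ord0 <= 1].

Definition moment2 (R : realType) (P : set 'cV[R]_2) : 'M[R]_2 :=
  \matrix_(i < 2, j < 2)
    fine (\int[(@lebesgue_measure R \x @lebesgue_measure R)%E]_(z in
             [set z : R * R | P (pt2 z.1 z.2)])
           ((pt2 z.1 z.2) i ord0 * (pt2 z.1 z.2) j ord0)%:E)%E.

(* Main.v *)
(* Let lam be a contravariant valuation. On the trapezoids
     T(p, q, f, g) = { p <= x <= q, g x <= y <= f x },  p < 0 < q,  f, g affine,
   the valuation property splits lam (T(p, q, f, g)) into a term depending on f and
   a term depending on g. Vertical scalings act on matrix entries with weights different
   from 1 and shears act by translation of f and g, so the only cocycles are
   coboundaries and lam (T(p, q, f, g)) = f . G + g . G for one matrix G = G(p, q).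
   Reading a rectangle in both coordinate directions expresses all G(p, q) by two
   constants, and reading a triangle in two directions relates these constants;
   hence lam vanishes on all trapezoids as soon as lam ([-1, 1]^2) has entry (0, 0) equal
   to 0. Cutting off the part of a polygon between its extreme vertices in one direction
   and the next level of vertices changes lam only by values on trapezoids, and finitely
   many such cuts reduce any polygon to a small square. Therefore lam = 0.
   This is applied to lam = mu - k M_2 of the polar, with k chosen to kill that entry. *)
Require Import Defs.
From HB Require Import structures.
From mathcomp Require Import all_boot all_order all_algebra.
From mathcomp Require Import all_classical all_reals all_analysis.
From mathcomp Require Import measurable_realfun.
From mathcomp Require Import ring lra.
Import Order.TTheory GRing.Theory Num.Theory.
Set Implicit Arguments. Unset Strict Implicit. Unset Printing Implicit Defensive.
Local Open Scope classical_set_scope.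
Local Open Scope ring_scope.

Local Notation "''x_0' v" := ((v : 'cV__) ord0 ord0) (at level 10, v at level 8).
Local Notation "''x_1' v" := ((v : 'cV__) (lift ord0 ord0) ord0) (at level 10, v at level 8).
Local Notation i0 := (ord0 : 'I_2).
Local Notation i1 := (lift ord0 ord0 : 'I_2).

(** * Convex hulls *)

Section Hull.
Context {R : realType}.
Implicit Types (x y z : 'cV[R]_2) (s : seq 'cV[R]_2) (P C : set 'cV[R]_2).

(** Over a fixed base [p, q] the affine function f0 + f1 x is identified with the matrix with rows
    (1, 0) and (f1, f0). Composing with a vertical scaling or shear is then matrix multiplication,
    and f . G is the contravariant action on G. The obstacle is that f and g are coupled: they may
    meet at an end of the base, and g may be positive away from the origin. The splitting is first
    obtained where f > 0 > g on all of [p, q], so that f and g vary independently, and is then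
    extended by one exchange with large constants. Triangles cannot be left out. A cap may end in a
    single vertex, and rectangles leave one parameter free, the symmetric off-diagonal part of G;
    only a sloped edge carries the off-diagonal entries into entry (0, 0). For the polar moment
    matrix, the valuation property rests on the convexity of [K] united with [L]: it makes the polar
    of the intersection the union of the polars. *)

Lemma pt2_x0 (a b : R) : 'x_0 (pt2 a b) = a.
Proof. by rewrite mxE. Qed.

Lemma pt2_x1 (a b : R) : 'x_1 (pt2 a b) = b.
Proof. by rewrite mxE. Qed.

Lemma pt2_eq x y : 'x_0 x = 'x_0 y -> 'x_1 x = 'x_1 y -> x = y.
Proof.
move=> e0 e1; apply/matrixP => i j; rewrite (ord1 j).
case: (unliftP ord0 i) => [k ->|-> //]; by rewrite (ord1 k).
Qed.

Lemma pt2_eta x : x = pt2 ('x_0 x) ('x_1 x).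
Proof. by apply: pt2_eq; rewrite ?pt2_x0 ?pt2_x1. Qed.

Definition cvx C := forall x y (t : R),
  C x -> C y -> 0 <= t -> t <= 1 -> C (t *: x + (1 - t) *: y).

Lemma hull_mem s x : x \in s -> conv_hull s x.
Proof.
move=> xs; have lt : (index x s < size s)%N by rewrite index_mem.
exists (fun i => (i == Ordinal lt)%:R); split=> [i|]; first by rewrite ler0n.
split.
  by rewrite (bigD1 (Ordinal lt)) //= eqxx big1 ?addr0 // => i /negPf ->.
rewrite (bigD1 (Ordinal lt)) //= eqxx scale1r big1 ?addr0 ?nth_index //.
by move=> i /negPf ->; rewrite scale0r.
Qed.

Lemma hull_cvx s : cvx (conv_hull s).
Proof.
move=> x y t [w [w0 [w1 ->]]] [v [v0 [v1 ->]]] t0 t1.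
exists (fun i => t * w i + (1 - t) * v i); split=> [i|].
  by rewrite addr_ge0 // mulr_ge0 // subr_ge0.
split; first by rewrite big_split /= -!mulr_sumr w1 v1; ring.
rewrite !scaler_sumr -big_split /=; apply: eq_bigr => i _.
by rewrite [in RHS]scalerDl !scalerA.
Qed.

Lemma hull_nil x : ~ conv_hull [::] x.
Proof. by move=> [w [_ [+ _]]]; rewrite big_ord0 => /esym/eqP; rewrite oner_eq0. Qed.

Lemma hull_cons p s x : conv_hull (p :: s) x ->
  x = p \/ exists z (t : R), [/\ conv_hull s z, 0 <= t, t <= 1 & x = t *: p + (1 - t) *: z].
Proof.
move=> [w [w0]]; rewrite !big_ord_recl /= => -[w1 ->].
set W := \sum_(i < _) _ in w1.
have W0 : 0 <= W by apply: sumr_ge0.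
have [WE|Wn] := eqVneq W 0.
  left; move: w1; rewrite WE addr0 => ->; rewrite scale1r big1 ?addr0 // => i _.
  move/eqP: WE; rewrite psumr_eq0; last by move=> j _; apply: w0.
  by move=> /allP/(_ i); rewrite mem_index_enum => /(_ isT)/eqP ->; rewrite scale0r.
right; exists (\sum_(i < size s) (w (lift ord0 i) / W) *: s`_i), (w ord0).
split.
- exists (fun i => w (lift ord0 i) / W); split=> [i|]; first exact: divr_ge0.
  by split=> //; rewrite -mulr_suml divff.
- exact: w0.
- by rewrite -w1 lerDl.
- congr (_ + _); rewrite -w1 addrC addKr scaler_sumr; apply: eq_bigr => i _.
  by rewrite scalerA mulrC divfK.
Qed.

Lemma hull_min s C : cvx C -> (forall p, p \in s -> C p) -> conv_hull s `<=` C.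
Proof.
move=> cC; elim: s => [_ x /hull_nil //|p s IH sC x /hull_cons[->|[z [t [zs t0 t1 ->]]]]].
  by apply: sC; rewrite mem_head.
apply: cC => //; first by apply: sC; rewrite mem_head.
by apply: IH => // q qs; apply: sC; rewrite in_cons qs orbT.
Qed.

Lemma hull_sub {s s'} : {subset s <= s'} -> conv_hull s `<=` conv_hull s'.
Proof. by move=> ss'; apply: hull_min (@hull_cvx s') _ => p /ss'/hull_mem. Qed.

(** There are three alternatives because either list may be empty, and then its hull is empty. In
    the last one, the new point [p] and the earlier point [a] are merged into one point of the first
    hull, weighted by their joint mass [t + (1 - t) * u]. *)
Lemma hull_cat {s s'} x : conv_hull (s ++ s') x -> [\/ conv_hull s x, conv_hull s' x |
  exists a b (t : R), [/\ conv_hull s a, conv_hull s' b & [/\ 0 <= t, t <= 1 & x = t *: a + (1 - t) *: b]]].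
Proof.
elim: s x => [|p s IH] x; first by move=> ?; apply: Or32.
move=> /hull_cons[->|[z [t [/IH zs t0 t1 ->]]]].
  by apply: Or31; apply: hull_mem; rewrite mem_head.
have psp : conv_hull (p :: s) p by apply: hull_mem; rewrite mem_head.
have sub : conv_hull s `<=` conv_hull (p :: s).
  by apply: hull_sub => q qs; rewrite in_cons qs orbT.
case: zs => [zs|zs|[a [b [u [as_ bs [u0 u1 ->]]]]]].
- by apply: Or31; apply: hull_cvx => //; apply: sub.
- by apply: Or33; exists p, z, t.
have [e|ne] := eqVneq (t + (1 - t) * u) 0.
  have te : t = 0 by apply/eqP; rewrite eq_le t0 andbT; nra.
  have ue : u = 0 by move: e; rewrite te; lra.
  by apply: Or32; rewrite te ue !scale0r !add0r !subr0 !scale1r.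
apply: Or33; exists ((t / (t + (1 - t) * u)) *: p + (1 - t / (t + (1 - t) * u)) *: a), b, (t + (1 - t) * u).
have pos : 0 < t + (1 - t) * u by rewrite lt_def ne addr_ge0 // mulr_ge0 // subr_ge0.
split=> //.
  apply: hull_cvx => //; first exact: sub.
    by rewrite divr_ge0 // ltW.
  by rewrite ler_pdivrMr // mul1r lerDl mulr_ge0 // subr_ge0.
split; [exact: ltW|nra|].
by apply: pt2_eq; rewrite !mxE; field.
Qed.

Lemma hull_lin (phi : 'M[R]_2) s :
  (fun x => phi *m x) @` conv_hull s = conv_hull [seq phi *m x | x <- s].
Proof.
apply/seteqP; split=> [_ [x xs <-]|].
  move: x xs; apply: hull_min => [x y t xs ys t0 t1|p ps] /=.
    by rewrite mulmxDr -!scalemxAr; apply: hull_cvx.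
  by apply: hull_mem; apply: map_f.
apply: hull_min => [_ _ t [x xs <-] [y ys <-] t0 t1|_ /mapP[p ps ->]] /=.
  by exists (t *: x + (1 - t) *: y); [apply: hull_cvx|rewrite mulmxDr -!scalemxAr].
by exists p => //; apply: hull_mem.
Qed.

(** A square neighbourhood of the origin in place of the Euclidean disc of [polyo]: interior
    conditions become separate linear inequalities in the two coordinates. *)
Definition boxin P := exists e : R, 0 < e /\
  forall a b : R, `|a| < e -> `|b| < e -> P (pt2 a b).

Lemma polyoP P : polyo P <-> (exists s, P = conv_hull s) /\ boxin P.
Proof.
split=> -[Ps [e [e0 eP]]]; split=> //.
  exists (e / 2); split=> [|a b ae be]; first by rewrite divr_gt0.
  apply: eP; rewrite /enorm pt2_x0 pt2_x1.
  rewrite -[ltRHS](ger0_norm (ltW e0)) -sqrtr_sqr ltr_sqrt; last by rewrite exprn_gt0.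
  have : a ^+ 2 < (e / 2) ^+ 2.
    by rewrite -(real_normK (num_real a)) ltrXn2r // ?ltW ?divr_gt0.
  have : b ^+ 2 < (e / 2) ^+ 2.
    by rewrite -(real_normK (num_real b)) ltrXn2r // ?ltW ?divr_gt0.
  nra.
exists e; split=> // x xe; rewrite (pt2_eta x); apply: eP.
  apply: le_lt_trans xe; rewrite /enorm -sqrtr_sqr ler_wsqrtr // lerDl sqr_ge0 //.
by apply: le_lt_trans xe; rewrite /enorm -sqrtr_sqr ler_wsqrtr // lerDr sqr_ge0.
Qed.

Lemma polyo_cvx P : polyo P -> cvx P.
Proof. by move=> [[s ->] _]; apply: hull_cvx. Qed.

Lemma mulmx_x0 (phi : 'M[R]_2) x :
  'x_0 (phi *m x) = phi ord0 ord0 * 'x_0 x + phi ord0 (lift ord0 ord0) * 'x_1 x.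
Proof. by rewrite !mxE !big_ord_recl big_ord0 addr0. Qed.

Lemma mulmx_x1 (phi : 'M[R]_2) x :
  'x_1 (phi *m x) = phi (lift ord0 ord0) ord0 * 'x_0 x
                    + phi (lift ord0 ord0) (lift ord0 ord0) * 'x_1 x.
Proof. by rewrite !mxE !big_ord_recl big_ord0 addr0. Qed.

Lemma polyo_lin (phi : 'M[R]_2) P : phi \in unitmx -> polyo P ->
  polyo ((fun x => phi *m x) @` P).
Proof.
move=> uphi /polyoP[[s ->] [e [e0 eP]]]; apply/polyoP; split.
  by exists [seq phi *m x | x <- s]; rewrite hull_lin.
set psi := invmx phi.
(* [M] exceeds both absolute row sums of the inverse, so the inverse maps the square of half-side
   [e / M] into the square of half-side [e]. *)
set M := 1 + `|psi ord0 ord0| + `|psi ord0 (lift ord0 ord0)|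
   + `|psi (lift ord0 ord0) ord0| + `|psi (lift ord0 ord0) (lift ord0 ord0)|.
have M0 : 0 < M by rewrite /M -!addrA ltr_pwDl // !addr_ge0.
exists (e / M); split=> [|a b aM bM]; first exact: divr_gt0.
exists (psi *m pt2 a b); last by rewrite mulmxA mulmxV // mul1mx.
rewrite (pt2_eta (psi *m _)); move: aM bM; rewrite !ltr_pdivlMr // => aM bM.
have na := normr_ge0 a; have nb := normr_ge0 b.
have bnd (u v : R) : 1 + `|u| + `|v| <= M -> `|u * a + v * b| < e.
  move=> uvM; apply: le_lt_trans (ler_normD _ _) _; rewrite !normrM.
  have nu := normr_ge0 u; have nv := normr_ge0 v.
  have [ab|ba] := leP `|a| `|b|; nra.
apply: eP.
  rewrite mulmx_x0 pt2_x0 pt2_x1; apply: bnd; rewrite /M -!addrA.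
  by rewrite !lerD2l lerDl addr_ge0.
rewrite mulmx_x1 pt2_x0 pt2_x1; apply: bnd; rewrite /M -!addrA.
by rewrite !lerD2l addrA lerDr addr_ge0.
Qed.

Lemma boxinI P C : boxin P -> boxin C -> boxin (P `&` C).
Proof.
move=> [e [e0 eP]] [d [d0 dC]]; exists (Num.min e d); split.
  by rewrite lt_min e0.
by move=> a b; rewrite !lt_min => /andP[? ?] /andP[? ?]; split; [apply: eP|apply: dC].
Qed.

End Hull.

(** * Trapezoids *)

Section Trapezoid.
Context {R : realType}.
Implicit Types (x y z : 'cV[R]_2) (s : seq 'cV[R]_2) (P C : set 'cV[R]_2).
Implicit Types (p q c : R).

Definition trap p q (f0 f1 g0 g1 : R) : set 'cV[R]_2 :=
  [set x | [/\ p <= 'x_0 x, 'x_0 x <= q, g0 + g1 * 'x_0 x <= 'x_1 x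
             & 'x_1 x <= f0 + f1 * 'x_0 x]].

Lemma trapP p q f0 f1 g0 g1 (a b : R) : trap p q f0 f1 g0 g1 (pt2 a b) <->
  [/\ p <= a, a <= q, g0 + g1 * a <= b & b <= f0 + f1 * a].
Proof. by rewrite /trap /= pt2_x0 pt2_x1. Qed.

Lemma trap_cvx p q f0 f1 g0 g1 : cvx (trap p q f0 f1 g0 g1).
Proof.
by move=> x y t [x1 x2 x3 x4] [y1 y2 y3 y4] t0 t1; split; rewrite !mxE; nra.
Qed.

Lemma segment_param (a b v : R) : a <= v -> v <= b ->
  exists t, [/\ 0 <= t, t <= 1 & v = t * a + (1 - t) * b].
Proof.
move=> av vb; have [ab|ba] := ltP a b; last by exists 1; split; lra.
have ba0 : 0 < b - a by rewrite subr_gt0.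
exists ((b - v) / (b - a)); split.
- by apply: divr_ge0; lra.
- by rewrite ler_pdivrMr // mul1r lerD2l lerN2.
- by field; rewrite gt_eqF.
Qed.

Lemma cvx_pt2_segment C (a b d v : R) : cvx C -> C (pt2 a b) -> C (pt2 a d) ->
  b <= v -> v <= d -> C (pt2 a v).
Proof.
move=> cC Cb Cd bv vd; have [t [t0 t1 ->]] := segment_param bv vd.
rewrite (_ : pt2 _ _ = t *: pt2 a b + (1 - t) *: pt2 a d); first exact: cC.
by apply: pt2_eq; rewrite !mxE /=; ring.
Qed.

(** Above a given abscissa, the points on the upper and on the lower edge are the same convex
    combination of corners, and the point considered lies on the vertical segment between them. *)
Lemma trap_sub_cvx p q f0 f1 g0 g1 C : p <= q -> cvx C ->
  C (pt2 p (f0 + f1 * p)) -> C (pt2 p (g0 + g1 * p)) ->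
  C (pt2 q (f0 + f1 * q)) -> C (pt2 q (g0 + g1 * q)) ->
  trap p q f0 f1 g0 g1 `<=` C.
Proof.
move=> pq cC C1 C2 C3 C4 x [x1 x2 x3 x4]; rewrite (pt2_eta x).
have [t [t0 t1 te]] := segment_param x1 x2.
have edge (h0 h1 : R) : C (pt2 p (h0 + h1 * p)) -> C (pt2 q (h0 + h1 * q)) ->
    C (pt2 ('x_0 x) (h0 + h1 * 'x_0 x)).
  move=> Cp Cq; rewrite (_ : pt2 _ _ = t *: pt2 p (h0 + h1 * p) + (1 - t) *: pt2 q (h0 + h1 * q)).
    exact: cC.
  by apply: pt2_eq; rewrite te !mxE /=; ring.
by apply: cvx_pt2_segment cC (edge g0 g1 _ _) (edge f0 f1 _ _) _ _.
Qed.

Lemma trap_hull p q f0 f1 g0 g1 : p <= q ->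
  g0 + g1 * p <= f0 + f1 * p -> g0 + g1 * q <= f0 + f1 * q ->
  trap p q f0 f1 g0 g1 = conv_hull
    [:: pt2 p (f0 + f1 * p); pt2 p (g0 + g1 * p);
        pt2 q (f0 + f1 * q); pt2 q (g0 + g1 * q)].
Proof.
move=> pq hp hq; apply/seteqP; split.
  by apply: trap_sub_cvx => //; [exact: hull_cvx|..]; apply: hull_mem;
    rewrite !inE eqxx ?orbT.
apply: hull_min; first exact: trap_cvx.
by move=> z; rewrite !inE => /or4P[] /eqP ->; apply/trapP; split; rewrite ?lexx.
Qed.

(* Equality of f and g at p or at q is allowed, so that triangles are included. *)
Definition trap_cond p q (f0 f1 g0 g1 : R) := [/\ p < 0, 0 < q, 0 < f0, g0 < 0 &
  g0 + g1 * p <= f0 + f1 * p /\ g0 + g1 * q <= f0 + f1 * q].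

Lemma linear_bound (d : R) c : 0 < c ->
  exists e : R, 0 < e /\ forall x : R, `|x| < e -> `|d * x| < c.
Proof.
move=> c0; exists (c / (1 + `|d|)); have d0 : 0 < 1 + `|d| by rewrite ltr_pwDl.
split=> [|x]; first exact: divr_gt0.
rewrite ltr_pdivlMr // normrM => xc; apply: le_lt_trans xc.
by rewrite mulrC ler_wpM2l // lerDr.
Qed.

Lemma trap_polyo p q f0 f1 g0 g1 : trap_cond p q f0 f1 g0 g1 -> polyo (trap p q f0 f1 g0 g1).
Proof.
move=> [p0 q0 f00 g00 [hp hq]]; apply/polyoP; split.
  by eexists; apply: trap_hull => //; rewrite ltW // (lt_trans p0).
have hf : 0 < f0 / 2 by lra.
have hg : 0 < - g0 / 2 by lra.
have [e [e0 ef]] := linear_bound f1 hf.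
have [d [d0 dg]] := linear_bound g1 hg.
exists (Num.min (Num.min e d) (Num.min (Num.min (- p) q) (Num.min (f0 / 2) (- g0 / 2)))).
split.
  by rewrite !lt_min e0 d0 q0 hf hg oppr_gt0 p0.
move=> a b; rewrite !lt_min => /andP[/andP[/ef + /dg +] /andP[/andP[+ +] _]].
rewrite !ltr_norml => /andP[? ?] /andP[? ?] /andP[? ?] /andP[? ?].
move=> /andP[_ /andP[_ /andP[/andP[? ?] /andP[? ?]]]].
by apply/trapP; split; lra.
Qed.

End Trapezoid.

(** * The contravariant action on matrices *)

Section Act.
Context {R : realType}.
Implicit Types (A B phi psi : 'M[R]_2).

Definition mx2 (a b c d : R) : 'M[R]_2 :=
  \matrix_(i < 2, j < 2) if i == ord0 then (if j == ord0 then a else b)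
                         else (if j == ord0 then c else d).

Lemma mx2E a b c d : (mx2 a b c d i0 i0 = a) * (mx2 a b c d i0 i1 = b) *
  (mx2 a b c d i1 i0 = c) * (mx2 a b c d i1 i1 = d).
Proof. by rewrite !mxE. Qed.

Lemma mx2_eq A B : A i0 i0 = B i0 i0 -> A i0 i1 = B i0 i1 ->
  A i1 i0 = B i1 i0 -> A i1 i1 = B i1 i1 -> A = B.
Proof.
move=> e00 e01 e10 e11; apply/matrixP => i j.
by case: (unliftP ord0 i) => [k ->|->]; case: (unliftP ord0 j) => [l ->|->] //;
  rewrite ?(ord1 k) ?(ord1 l).
Qed.

Lemma mulmx2E A B i j : (A *m B) i j = A i i0 * B i0 j + A i i1 * B i1 j.
Proof. by rewrite !mxE !big_ord_recl big_ord0 addr0. Qed.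

Lemma det_mx2 A : \det A = A i0 i0 * A i1 i1 - A i0 i1 * A i1 i0.
Proof.
rewrite (expand_det_row _ ord0) !big_ord_recl big_ord0 /cofactor !det_mx11 !mxE /=.
have -> : lift (lift ord0 ord0) 0 = i0 by apply: val_inj.
by rewrite expr0 expr1; ring.
Qed.

Definition act phi A : 'M[R]_2 :=
  `|\det phi|^-1 *: ((invmx phi)^T *m A *m invmx phi).

Lemma actD phi A B : act phi (A + B) = act phi A + act phi B.
Proof. by rewrite /act mulmxDr mulmxDl scalerDr. Qed.

Lemma actZ phi k A : act phi (k *: A) = k *: act phi A.
Proof. by rewrite /act -scalemxAr -scalemxAl !scalerA mulrC. Qed.

Lemma actN phi A : act phi (- A) = - act phi A.
Proof. by rewrite -scaleN1r actZ scaleN1r. Qed.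

Lemma act0 phi : act phi 0 = 0.
Proof. by rewrite /act mulmx0 mul0mx scaler0. Qed.

Lemma invmx_unique phi psi : phi *m psi = 1%:M -> invmx phi = psi.
Proof.
by move=> e; have [u _] := mulmx1_unit e; rewrite -[LHS]mulmx1 -e mulKmx.
Qed.

Lemma actM phi psi A : phi \in unitmx -> psi \in unitmx ->
  act (phi *m psi) A = act phi (act psi A).
Proof.
move=> u v; rewrite /act -scalemxAr -scalemxAl scalerA det_mulmx normrM invfM.
have -> : invmx (phi *m psi) = invmx psi *m invmx phi.
  by apply: invmx_unique; rewrite mulmxA mulmxK // mulmxV.
by rewrite trmx_mul !mulmxA.
Qed.

(** The linear maps that preserve every vertical line: scaling by [c] followed by a shear of slope
    [t]. They permute the trapezoids over a fixed base. *)
Definition lowmx (t c : R) := mx2 1 0 t c.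

Lemma lowmx_unit t c : c != 0 -> lowmx t c \in unitmx.
Proof. by move=> c0; rewrite unitmxE det_mx2 !mx2E unitfE mul1r mul0r subr0. Qed.

Lemma lowmxM t c t' c' : lowmx t c *m lowmx t' c' = lowmx (t + c * t') (c * c').
Proof. by apply: mx2_eq; rewrite !mulmx2E !mx2E; ring. Qed.

(** The action is triangular: entry (1, 1) only sees itself, the off-diagonal entries also see (1,
    1), and (0, 0) sees everything. For [t = 0] and c > 0 it is diagonal with weights c^-1, c^-2,
    c^-2, c^-3. *)
Lemma act_lowE t c A : c != 0 ->
  [/\ act (lowmx t c) A i0 i0 =
        (A i0 i0 - t / c * (A i0 i1 + A i1 i0) + (t / c) ^+ 2 * A i1 i1) / `|c|,
      act (lowmx t c) A i0 i1 = (A i0 i1 - t / c * A i1 i1) / c / `|c|,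
      act (lowmx t c) A i1 i0 = (A i1 i0 - t / c * A i1 i1) / c / `|c|
    & act (lowmx t c) A i1 i1 = A i1 i1 / c ^+ 2 / `|c| ].
Proof.
move=> c0; rewrite /act det_mx2 !mx2E mul1r mul0r subr0.
have -> : invmx (lowmx t c) = lowmx (- t / c) c^-1.
  apply: invmx_unique; rewrite lowmxM; apply: mx2_eq; rewrite !mx2E !mxE //=.
    by field.
  by rewrite divff.
have n0 : `|c| != 0 by rewrite normr_eq0.
have sE B i j : (`|c|^-1 *: B) i j = B i j / `|c| by rewrite mxE mulrC.
by split; rewrite sE !mulmx2E ![(_^T)%R _ _]mxE !mx2E; field; rewrite n0 c0.
Qed.

Definition swapmx : 'M[R]_2 := mx2 0 1 1 0.

Lemma swapmxK : swapmx *m swapmx = 1%:M.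
Proof. by apply: mx2_eq; rewrite !mulmx2E !mx2E !mxE /=; ring. Qed.

Lemma swapmx_unit : swapmx \in unitmx.
Proof. by have [] := mulmx1_unit swapmxK. Qed.

Lemma act_swapE A : act swapmx A = mx2 (A i1 i1) (A i1 i0) (A i0 i1) (A i0 i0).
Proof.
rewrite /act (invmx_unique swapmxK) det_mx2 !mx2E mul0r mul1r sub0r normrN normr1 invr1 scale1r.
by apply: mx2_eq; rewrite !mulmx2E ![(_^T)%R _ _]mxE !mx2E; ring.
Qed.

End Act.

(** * Splitting a valuation on trapezoids *)

Section Separation.
Context {R : realType} (p q : R).
Hypotheses (p0 : p < 0) (q0 : 0 < q).
Implicit Types (t c : R).

(** Positivity at both ends, hence on all of [p, q]. If f and -g both satisfy it, then f and g can
    be replaced independently of each other, whereas [trap_cond] ties g to f by g <= f at the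
    ends. *)
Definition posaff (f0 f1 : R) := 0 < f0 + f1 * p /\ 0 < f0 + f1 * q.

Lemma posaff_gt0 f0 f1 : posaff f0 f1 -> 0 < f0.
Proof.
have pn := p0; have qp0 := q0; move=> [h1 h2]; have: 0 < q * (f0 + f1 * p) - p * (f0 + f1 * q).
  by rewrite subr_gt0 (@lt_trans _ _ 0) ?nmulr_rlt0 ?mulr_gt0.
have qp : 0 < q - p by move: p0 q0; lra.
have -> : q * (f0 + f1 * p) - p * (f0 + f1 * q) = f0 * (q - p) by ring.
by rewrite pmulr_lgt0.
Qed.

Lemma posaff_cst c : 0 < c -> posaff c 0.
Proof. by rewrite /posaff !mul0r addr0. Qed.

Lemma posaffZ c f0 f1 : 0 < c -> posaff f0 f1 -> posaff (c * f0) (c * f1).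
Proof. by move=> c0 [h1 h2]; rewrite /posaff -!mulrA -!mulrDr !pmulr_rgt0. Qed.

Lemma posaff_trap_cond f0 f1 g0 g1 : posaff f0 f1 -> posaff (- g0) (- g1) -> trap_cond p q f0 f1 g0 g1.
Proof.
move=> hf hg; have := posaff_gt0 hf; have := posaff_gt0 hg.
by move: hf hg => [? ?] [? ?]; rewrite oppr_gt0; split=> //; split; lra.
Qed.

Lemma posaff_ge_cst f0 f1 f0' f1' : posaff f0 f1 -> posaff f0' f1' -> exists c,
  [/\ 0 < c, c <= f0 + f1 * p, c <= f0 + f1 * q, c <= f0' + f1' * p & c <= f0' + f1' * q].
Proof.
move=> [h1 h2] [h3 h4].
exists (Num.min (Num.min (f0 + f1 * p) (f0 + f1 * q)) (Num.min (f0' + f1' * p) (f0' + f1' * q))).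
by rewrite !lt_min h1 h2 h3 h4 !ge_min !lexx !orbT.
Qed.

Section Scalar.
Variable l : R -> R -> R -> R -> R.
Hypothesis lV : forall f0 f1 g0 g1 f0' f1' g0' g1',
  trap_cond p q f0 f1 g0 g1 -> trap_cond p q f0' f1' g0' g1' ->
  trap_cond p q f0 f1 g0' g1' -> trap_cond p q f0' f1' g0 g1 ->
  f0 + f1 * p <= f0' + f1' * p -> f0 + f1 * q <= f0' + f1' * q ->
  g0 + g1 * p <= g0' + g1' * p -> g0 + g1 * q <= g0' + g1' * q ->
  l f0' f1' g0 g1 + l f0 f1 g0' g1' = l f0 f1 g0 g1 + l f0' f1' g0' g1'.

(** The two upper functions need not be comparable, so [lV] does not apply to them directly. Each of
    the four pairs is compared with a constant pair [e], [- d] lying below both upper and above both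
    lower functions; the terms containing [e] or [- d] cancel. *)
Lemma scalar_diff f0 f1 f0' f1' g0 g1 g0' g1' :
  posaff f0 f1 -> posaff f0' f1' -> posaff (- g0) (- g1) -> posaff (- g0') (- g1') ->
  l f0 f1 g0 g1 - l f0' f1' g0 g1 = l f0 f1 g0' g1' - l f0' f1' g0' g1'.
Proof.
move=> pf pf' pg pg'.
have [e [e0 e1 e2 e3 e4]] := posaff_ge_cst pf pf'.
have [d [d0 d1 d2 d3 d4]] := posaff_ge_cst pg pg'.
have pe := posaff_cst e0; have pd : posaff (- - d) (- 0) by rewrite opprK oppr0; apply: posaff_cst.
have V h0 h1 k0 k1 : posaff h0 h1 -> posaff (- k0) (- k1) ->
    e <= h0 + h1 * p -> e <= h0 + h1 * q -> d <= - k0 + (- k1) * p -> d <= - k0 + (- k1) * q ->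
    l h0 h1 k0 k1 + l e 0 (- d) 0 = l e 0 k0 k1 + l h0 h1 (- d) 0.
  by move=> ph pk ? ? ? ?; apply: lV; try (by apply: posaff_trap_cond); lra.
have := V _ _ _ _ pf pg e1 e2 d1 d2; have := V _ _ _ _ pf' pg e3 e4 d1 d2.
have := V _ _ _ _ pf pg' e1 e2 d3 d4; have := V _ _ _ _ pf' pg' e3 e4 d3 d4.
by lra.
Qed.

Variables (k : R -> R) (r : R).
Hypothesis kh : k 2^-1 != 1.
Hypothesis rr : r * r = 1.
Hypothesis lS : forall c f0 f1 g0 g1, 0 < c -> posaff f0 f1 -> posaff (- g0) (- g1) ->
  l (c * f0) (c * f1) (c * g0) (c * g1) = k c * l f0 f1 g0 g1.
Hypothesis lR : forall f0 f1 g0 g1, posaff f0 f1 -> posaff (- g0) (- g1) ->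
  l (- g0) (- g1) (- f0) (- f1) = r * l f0 f1 g0 g1.

(* Scaling by 1/2 multiplies l by k(1/2) <> 1, so a is obtained by solving
   a f - a (f/2) = l f g - l (f/2) g, whose right-hand side does not depend on g. *)
Lemma scalar_split : exists a : R -> R -> R,
  (forall f0 f1 g0 g1, posaff f0 f1 -> posaff (- g0) (- g1) ->
     l f0 f1 g0 g1 = a f0 f1 + r * a (- g0) (- g1)) /\
  (forall c f0 f1, 0 < c -> posaff f0 f1 -> a (c * f0) (c * f1) = k c * a f0 f1).
Proof.
have h2 : 0 < 2^-1 :> R by rewrite invr_gt0.
have ph h0 h1 : posaff h0 h1 -> posaff (2^-1 * h0) (2^-1 * h1) by apply: posaffZ.
have p1 : posaff 1 0 by apply: posaff_cst.
have n1 c : 0 < c -> posaff (- (- c)) (- 0) by rewrite opprK oppr0; apply: posaff_cst.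
have kn : 1 - k 2^-1 != 0 by rewrite subr_eq0 eq_sym.
exists (fun f0 f1 => (l f0 f1 (- 1) 0 - l (2^-1 * f0) (2^-1 * f1) (- 1) 0) / (1 - k 2^-1)).
split=> [f0 f1 g0 g1 pf pg|c f0 f1 c0 pf].
  have pg' := ph _ _ pg.
  have pgh : posaff (- (2^-1 * g0)) (- (2^-1 * g1)) by rewrite -!mulrN.
  (* Reflection turns the pair (-g, -1) into (1, g). By [D] the two differences then telescope to l
     f g - l (f/2) (g/2), which is (1 - k(1/2)) times l f g by [S]. *)
  have := lR p1 pg; have := lR p1 pgh; rewrite oppr0 !mulrN => -> ->.
  have := @scalar_diff _ _ _ _ _ _ _ _ pf (ph _ _ pf) pg (n1 1 ltr01) => <-.
  have D := @scalar_diff _ _ _ _ _ _ _ _ p1 (ph _ _ pf) pg pgh.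
  have S := lS h2 pf pg.
  apply: (mulIf kn); rewrite mulrDl -[r * _ * _]mulrA !divfK // [in RHS]mulrBr !mulrA rr !mul1r.
  rewrite mulrBr mulr1 (mulrC _ (k _)) -S.
  lra.
have D : l (c * f0) (c * f1) (- 1) 0 - l (2^-1 * (c * f0)) (2^-1 * (c * f1)) (- 1) 0 =
   l (c * f0) (c * f1) (c * -1) (c * 0) - l (c * (2^-1 * f0)) (c * (2^-1 * f1)) (c * -1) (c * 0).
  rewrite !(mulrCA c 2^-1) mulrN1 mulr0; apply: scalar_diff; last exact: n1.
  - exact: posaffZ.
  - by apply: ph; apply: posaffZ.
  - exact: n1.
by rewrite D !lS //; [rewrite -mulrBr mulrA|apply: ph|apply: n1|apply: n1].
Qed.

End Scalar.

Variable L : R -> R -> R -> R -> 'M[R]_2.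
Hypothesis LV : forall f0 f1 g0 g1 f0' f1' g0' g1',
  trap_cond p q f0 f1 g0 g1 -> trap_cond p q f0' f1' g0' g1' ->
  trap_cond p q f0 f1 g0' g1' -> trap_cond p q f0' f1' g0 g1 ->
  f0 + f1 * p <= f0' + f1' * p -> f0 + f1 * q <= f0' + f1' * q ->
  g0 + g1 * p <= g0' + g1' * p -> g0 + g1 * q <= g0' + g1' * q ->
  L f0' f1' g0 g1 + L f0 f1 g0' g1' = L f0 f1 g0 g1 + L f0' f1' g0' g1'.
Hypothesis LS : forall t c f0 f1 g0 g1, 0 < c -> trap_cond p q f0 f1 g0 g1 ->
  L (c * f0) (t + c * f1) (c * g0) (t + c * g1) = act (lowmx t c) (L f0 f1 g0 g1).
Hypothesis LR : forall f0 f1 g0 g1, trap_cond p q f0 f1 g0 g1 ->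
  L (- g0) (- g1) (- f0) (- f1) = act (lowmx 0 (- 1)) (L f0 f1 g0 g1).

(** Vertical scalings and the reflection act diagonally on entries, with weights c^-1, c^-2, c^-2,
    c^-3 and signs 1, -1, -1, 1. No weight is 1 at c = 1/2, so [scalar_split] applies to each entry
    separately. *)
Lemma alpha_exists : exists a : R -> R -> 'M[R]_2,
  (forall f0 f1 g0 g1, posaff f0 f1 -> posaff (- g0) (- g1) ->
     L f0 f1 g0 g1 = a f0 f1 + act (lowmx 0 (- 1)) (a (- g0) (- g1))) /\
  (forall c f0 f1, 0 < c -> posaff f0 f1 ->
     a (c * f0) (c * f1) = act (lowmx 0 c) (a f0 f1)).
Proof.
have LVij i j : forall f0 f1 g0 g1 f0' f1' g0' g1',
  trap_cond p q f0 f1 g0 g1 -> trap_cond p q f0' f1' g0' g1' ->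
  trap_cond p q f0 f1 g0' g1' -> trap_cond p q f0' f1' g0 g1 ->
  f0 + f1 * p <= f0' + f1' * p -> f0 + f1 * q <= f0' + f1' * q ->
  g0 + g1 * p <= g0' + g1' * p -> g0 + g1 * q <= g0' + g1' * q ->
  L f0' f1' g0 g1 i j + L f0 f1 g0' g1' i j = L f0 f1 g0 g1 i j + L f0' f1' g0' g1' i j.
  move=> f0 f1 g0 g1 f0' f1' g0' g1' o1 o2 o3 o4 l1 l2 l3 l4.
  by have /matrixP/(_ i j) := LV o1 o2 o3 o4 l1 l2 l3 l4; rewrite !mxE.
have LSij c f0 f1 g0 g1 : 0 < c -> posaff f0 f1 -> posaff (- g0) (- g1) ->
    L (c * f0) (c * f1) (c * g0) (c * g1) = act (lowmx 0 c) (L f0 f1 g0 g1).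
  by move=> c0 pf pg; have := LS 0 c0 (posaff_trap_cond pf pg); rewrite !add0r.
have m1 : - 1 != 0 :> R by rewrite oppr_eq0 oner_neq0.
have c0n c : 0 < c -> c != 0 by move=> ?; rewrite gt_eqF.
have [a00 [s00 z00]] : exists a : R -> R -> R,
  (forall f0 f1 g0 g1, posaff f0 f1 -> posaff (- g0) (- g1) ->
     L f0 f1 g0 g1 i0 i0 = a f0 f1 + 1 * a (- g0) (- g1)) /\
  (forall c f0 f1, 0 < c -> posaff f0 f1 -> a (c * f0) (c * f1) = c^-1 * a f0 f1).
  apply: (@scalar_split (fun f0 f1 g0 g1 => L f0 f1 g0 g1 i0 i0) _ (fun c => c^-1) 1).
  - exact: LVij.
  - by apply/eqP; lra.
  - by rewrite mul1r.
  - move=> c f0 f1 g0 g1 c0 pf pg; rewrite LSij //.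
    by have [-> _ _ _] := act_lowE 0 (L f0 f1 g0 g1) (c0n _ c0); rewrite gtr0_norm //; field; exact: c0n.
  - move=> f0 f1 g0 g1 pf pg; rewrite LR; last exact: posaff_trap_cond.
    by have [-> _ _ _] := act_lowE 0 (L f0 f1 g0 g1) m1; rewrite normrN1; field.
have [a01 [s01 z01]] : exists a : R -> R -> R,
  (forall f0 f1 g0 g1, posaff f0 f1 -> posaff (- g0) (- g1) ->
     L f0 f1 g0 g1 i0 i1 = a f0 f1 + (- 1) * a (- g0) (- g1)) /\
  (forall c f0 f1, 0 < c -> posaff f0 f1 -> a (c * f0) (c * f1) = (c ^+ 2)^-1 * a f0 f1).
  apply: (@scalar_split (fun f0 f1 g0 g1 => L f0 f1 g0 g1 i0 i1) _ (fun c => (c ^+ 2)^-1) (- 1)).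
  - exact: LVij.
  - by apply/eqP; rewrite exprVn invrK; lra.
  - by rewrite mulrNN mul1r.
  - move=> c f0 f1 g0 g1 c0 pf pg; rewrite LSij //.
    by have [_ -> _ _] := act_lowE 0 (L f0 f1 g0 g1) (c0n _ c0); rewrite gtr0_norm //; field; exact: c0n.
  - move=> f0 f1 g0 g1 pf pg; rewrite LR; last exact: posaff_trap_cond.
    by have [_ -> _ _] := act_lowE 0 (L f0 f1 g0 g1) m1; rewrite normrN1; field.
have [a10 [s10 z10]] : exists a : R -> R -> R,
  (forall f0 f1 g0 g1, posaff f0 f1 -> posaff (- g0) (- g1) ->
     L f0 f1 g0 g1 i1 i0 = a f0 f1 + (- 1) * a (- g0) (- g1)) /\
  (forall c f0 f1, 0 < c -> posaff f0 f1 -> a (c * f0) (c * f1) = (c ^+ 2)^-1 * a f0 f1).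
  apply: (@scalar_split (fun f0 f1 g0 g1 => L f0 f1 g0 g1 i1 i0) _ (fun c => (c ^+ 2)^-1) (- 1)).
  - exact: LVij.
  - by apply/eqP; rewrite exprVn invrK; lra.
  - by rewrite mulrNN mul1r.
  - move=> c f0 f1 g0 g1 c0 pf pg; rewrite LSij //.
    by have [_ _ -> _] := act_lowE 0 (L f0 f1 g0 g1) (c0n _ c0); rewrite gtr0_norm //; field; exact: c0n.
  - move=> f0 f1 g0 g1 pf pg; rewrite LR; last exact: posaff_trap_cond.
    by have [_ _ -> _] := act_lowE 0 (L f0 f1 g0 g1) m1; rewrite normrN1; field.
have [a11 [s11 z11]] : exists a : R -> R -> R,
  (forall f0 f1 g0 g1, posaff f0 f1 -> posaff (- g0) (- g1) ->
     L f0 f1 g0 g1 i1 i1 = a f0 f1 + 1 * a (- g0) (- g1)) /\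
  (forall c f0 f1, 0 < c -> posaff f0 f1 -> a (c * f0) (c * f1) = (c ^+ 3)^-1 * a f0 f1).
  apply: (@scalar_split (fun f0 f1 g0 g1 => L f0 f1 g0 g1 i1 i1) _ (fun c => (c ^+ 3)^-1) 1).
  - exact: LVij.
  - by apply/eqP; rewrite exprVn invrK; lra.
  - by rewrite mul1r.
  - move=> c f0 f1 g0 g1 c0 pf pg; rewrite LSij //.
    by have [_ _ _ ->] := act_lowE 0 (L f0 f1 g0 g1) (c0n _ c0); rewrite gtr0_norm //; field; exact: c0n.
  - move=> f0 f1 g0 g1 pf pg; rewrite LR; last exact: posaff_trap_cond.
    by have [_ _ _ ->] := act_lowE 0 (L f0 f1 g0 g1) m1; rewrite normrN1; field.
exists (fun f0 f1 => mx2 (a00 f0 f1) (a01 f0 f1) (a10 f0 f1) (a11 f0 f1)).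
split=> [f0 f1 g0 g1 pf pg|c f0 f1 c0 pf].
  set A := mx2 (a00 (- g0) _) _ _ _.
  have AE (B C : 'M[R]_2) i j : (B + C) i j = B i j + C i j by rewrite mxE.
  have [e1 e2 e3 e4] := act_lowE 0 A m1; rewrite normrN1 in e1 e2 e3 e4.
  by apply: mx2_eq; rewrite AE ?e1 ?e2 ?e3 ?e4 ?s00 ?s01 ?s10 ?s11 // !mx2E; field.
set A := mx2 (a00 f0 _) _ _ _.
have [e1 e2 e3 e4] := act_lowE 0 A (c0n _ c0); rewrite gtr0_norm // in e1 e2 e3 e4.
by apply: mx2_eq; rewrite ?e1 ?e2 ?e3 ?e4 !mx2E ?z00 ?z01 ?z10 ?z11 //; field; exact: c0n.
Qed.

(* Applied to the value A at t of a shear cocycle: its value at 2 t is computed once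
   by scaling and once by the cocycle identity. *)
Lemma shear_rigid t (A : 'M[R]_2) :
  act (lowmx 0 2) A = A + act (lowmx t 1) A -> A = 0.
Proof.
have n2 : (2 : R) != 0 by rewrite pnatr_eq0.
have [e1 e2 e3 e4] := act_lowE 0 A n2; have [d1 d2 d3 d4] := act_lowE t A (oner_neq0 R).
rewrite gtr0_norm // in e1 e2 e3 e4; rewrite normr1 in d1 d2 d3 d4.
move=> E.
have EE i j : act (lowmx 0 2) A i j = A i j + act (lowmx t 1) A i j.
  by have /matrixP/(_ i j) := E; rewrite [in RHS]mxE.
(* Solved from (1, 1) upwards, following the triangular shape of the shear. Once the entries below
   vanish, the equations read A/8 = 2A, A/4 = 2A and A/2 = 2A. *)
have := EE i1 i1; rewrite e4 d4 => h4.
have a11 : A i1 i1 = 0 by lra.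
have := EE i1 i0; rewrite e3 d3 a11 => h3.
have := EE i0 i1; rewrite e2 d2 a11 => h2.
have a10 : A i1 i0 = 0 by lra.
have a01 : A i0 i1 = 0 by lra.
have := EE i0 i0; rewrite e1 d1 a11 a10 a01 => h1.
by apply: mx2_eq; rewrite ?a11 ?a10 ?a01 mxE //; lra.
Qed.

Lemma separation : exists G : 'M[R]_2, forall f0 f1 g0 g1, trap_cond p q f0 f1 g0 g1 ->
  L f0 f1 g0 g1 = act (lowmx f1 f0) G + act (lowmx g1 g0) G.
Proof.
have [a [aL aS]] := alpha_exists.
pose b g0 g1 := act (lowmx 0 (- 1)) (a (- g0) (- g1)).
have LS1 t f0 f1 g0 g1 : trap_cond p q f0 f1 g0 g1 ->
    L f0 (t + f1) g0 (t + g1) = act (lowmx t 1) (L f0 f1 g0 g1).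
  by move=> o; rewrite -LS // !mul1r.
(* Room for shearing: the constant [D] is so large that it stays positive on [p, q] after adding any
   slope of size at most [|t|]. *)
have big t : exists D, 0 < D /\ forall s : R, `|s| <= 1 -> posaff D (s * t).
  exists (1 + `|t| * (q - p)); split=> [|s s1].
    by rewrite ltr_pwDl // mulr_ge0 //; move: p0 q0; lra.
  have st : `|s * t| <= `|t| by rewrite normrM ler_piMl.
  have pn := p0; have qp := q0.
  by move: st; rewrite ler_norml => /andP[? ?]; split; nra.
(* The failure of [a] to commute with a shear does not depend on f: shearing the trapezoid between f
   and a fixed low constant [- D] shows that it is the opposite of the same failure for the lower
   term. *)
have indep t f0 f1 f0' f1' : posaff f0 f1 -> posaff f0' f1' ->
    posaff f0 (t + f1) -> posaff f0' (t + f1') ->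
    a f0 (t + f1) - act (lowmx t 1) (a f0 f1) = a f0' (t + f1') - act (lowmx t 1) (a f0' f1').
  have [D [D0 hD]] := big t.
  have pD : posaff (- - D) (- 0) by rewrite opprK oppr0; apply: posaff_cst.
  have pDt : posaff (- - D) (- (t + 0)) by rewrite opprK addr0 -mulN1r; apply: hD; rewrite normrN1.
  have H h0 h1 : posaff h0 h1 -> posaff h0 (t + h1) ->
     a h0 (t + h1) - act (lowmx t 1) (a h0 h1) = act (lowmx t 1) (b (- D) 0) - b (- D) (t + 0).
    move=> ph pht; have := LS1 t _ _ _ _ (posaff_trap_cond ph pD).
    rewrite !aL // actD -/(b _ _) -/(b _ _) => E.
    by apply/eqP; rewrite subr_eq addrAC eq_sym subr_eq eq_sym E addrC.
  by move=> *; rewrite !H.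
have shear t f0 f1 : posaff f0 f1 -> posaff f0 (t + f1) ->
    a f0 (t + f1) = act (lowmx t 1) (a f0 f1).
  move=> pf pft; apply/eqP; rewrite -subr_eq0; apply/eqP.
  have [C [C0 hC]] := big (2 * t).
  have pC0 := posaff_cst C0.
  have pCt : posaff C (t + 0).
    rewrite addr0 (_ : t = 2^-1 * (2 * t)); last by field.
    by apply: hC; rewrite ger0_norm //; lra.
  have pC2t : posaff C (t + (t + 0)).
    by rewrite (_ : t + _ = 1 * (2 * t)); [apply: hC; rewrite normr1|ring].
  have p2C : posaff (2 * C) 0 by apply: posaff_cst; lra.
  rewrite (indep _ _ _ C 0) //.
  set X := (X in X = 0); apply: (@shear_rigid t).
  (* The failure for slope 2t is computed twice: at [2 * C] it is the failure [X] for slope t scaled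
     by 2, and at [C] it is [X] plus the sheared [X]. *)
  have E1 := indep t C (t + 0) C 0 pCt pC0 pC2t pCt.
  have p2Ct : posaff (2 * C) (2 * t + 0).
    by have := posaffZ (ltr0Sn R 1) pCt; rewrite !addr0.
  have pC2t' : posaff C (2 * t + 0) by rewrite (_ : 2 * t + 0 = t + (t + 0)) //; ring.
  have E2 := indep (2 * t) (2 * C) 0 C 0 p2C pC0 p2Ct pC2t'.
  have e3 : a (2 * C) (2 * t + 0) = act (lowmx 0 2) (a C (t + 0)).
    by rewrite -aS // mulrDr mulr0.
  have e4 : a (2 * C) 0 = act (lowmx 0 2) (a C 0) by rewrite -aS // mulr0.
  have u2 (s : R) : lowmx s 1 \in unitmx by apply: lowmx_unit; rewrite oner_neq0.
  have v2 : lowmx 0 (2 : R) \in unitmx by apply: lowmx_unit; rewrite pnatr_eq0.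
  have e5 B : act (lowmx (2 * t) 1) (act (lowmx 0 2) B) = act (lowmx 0 2) (act (lowmx t 1) B).
    by rewrite -!actM // !lowmxM; congr (act (lowmx _ _) _); ring.
  have e6 B : act (lowmx (2 * t) 1) B = act (lowmx t 1) (act (lowmx t 1) B).
    by rewrite -!actM // !lowmxM; congr (act (lowmx _ _) _); ring.
  have -> : act (lowmx 0 2) X = a C (2 * t + 0) - act (lowmx (2 * t) 1) (a C 0).
    by rewrite -E2 e3 e4 e5 /X actD actN.
  rewrite (_ : 2 * t + 0 = t + (t + 0)); last by ring.
  rewrite e6 -[a C (t + (t + 0))](subrK (act (lowmx t 1) (a C (t + 0)))) E1 -/X.
  by rewrite /X actD actN; rewrite !addrA.
pose G := a 1 0; exists G.
have aG f0 f1 : posaff f0 f1 -> a f0 f1 = act (lowmx f1 f0) G.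
  move=> pf; have f00 := posaff_gt0 pf.
  have := shear f1 f0 0 (posaff_cst f00); rewrite addr0 => -> //.
  have := aS f0 1 0 f00 (posaff_cst ltr01); rewrite mulr1 mulr0 => ->.
  rewrite -actM ?lowmx_unit ?oner_neq0 ?gt_eqF // lowmxM.
  by rewrite mulr0 addr0 mul1r.
have LG f0 f1 g0 g1 : posaff f0 f1 -> posaff (- g0) (- g1) ->
    L f0 f1 g0 g1 = act (lowmx f1 f0) G + act (lowmx g1 g0) G.
  move=> pf pg; rewrite aL // !aG // -actM; last 2 first.
  - by rewrite lowmx_unit // oppr_eq0 oner_neq0.
  - by rewrite lowmx_unit // gt_eqF // (posaff_gt0 pg).
  by rewrite lowmxM !mulN1r !opprK add0r.
have shG t h0 h1 : h0 != 0 ->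
    act (lowmx t 1) (act (lowmx h1 h0) G) = act (lowmx (t + h1) h0) G.
  by move=> h; rewrite -actM ?lowmx_unit ?oner_neq0 // lowmxM !mul1r.
(* Extension to lower functions that are not negative on the whole base or that meet f at an end.
   The upper edge is raised to a constant [C] and the lower edge moved down to [- D]. Of the four
   trapezoids in the exchange [V], two fall under [LG], and the one between g and [C] does so after
   a shear that makes g constant. *)
have flat f0 g0 g1 : trap_cond p q f0 0 g0 g1 ->
    L f0 0 g0 g1 = act (lowmx 0 f0) G + act (lowmx g1 g0) G.
  move=> o; have [_ _ f00 g00 [hp hq]] := o; rewrite !mul0r addr0 in hp hq.
  have [D0 [D00 hD]] := big g1; pose C := Num.max D0 f0.
  have C0 : 0 < C by rewrite lt_max D00.
  have fC : f0 <= C by rewrite le_max lexx orbT.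
  have pC : posaff C (- g1).
    have [h1 h2] := hD (- 1) ltac:(by rewrite normrN1).
    have : D0 <= C by rewrite le_max lexx.
    by split; lra.
  pose D := Num.max 1 (Num.max (- (g0 + g1 * p)) (- (g0 + g1 * q))).
  have D1 : 1 <= D by rewrite le_max lexx.
  have Dp : - (g0 + g1 * p) <= D by rewrite !le_max lexx orbT.
  have Dq : - (g0 + g1 * q) <= D by rewrite !le_max lexx !orbT.
  have pD : posaff (- - D) (- 0) by rewrite opprK oppr0; apply: posaff_cst; lra.
  have pg0 : posaff (- g0) (- 0) by rewrite oppr0; apply: posaff_cst; rewrite oppr_gt0.
  have oCg : trap_cond p q C 0 g0 g1 by split=> //; split; lra.
  have V : L C 0 (- D) 0 + L f0 0 g0 g1 = L f0 0 (- D) 0 + L C 0 g0 g1.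
    apply: LV => //; try lra.
    - by apply: posaff_trap_cond => //; apply: posaff_cst.
    - by apply: posaff_trap_cond => //; apply: posaff_cst.
  have H : L C 0 g0 g1 = act (lowmx 0 C) G + act (lowmx g1 g0) G.
    have := LS1 g1 _ _ _ _ (posaff_trap_cond pC pg0); rewrite subrr addr0 => ->.
    by rewrite LG // actD !shG ?(lt_eqF g00) ?(gt_eqF C0) // subrr addr0.
  have pc c : 0 < c -> posaff c 0 by apply: posaff_cst.
  apply: (addrI (L C 0 (- D) 0)); rewrite V H !LG //; try exact: pc.
  by rewrite addrACA [RHS]addrACA; congr (_ + _); rewrite addrC.
move=> f0 f1 g0 g1 [_ _ f00 g00 [hp hq]].
have o : trap_cond p q f0 0 g0 (g1 - f1) by split=> //; split; lra.
have E : f1 + (g1 - f1) = g1 by ring.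
have := LS1 f1 _ _ _ _ o; rewrite addr0 E => ->.
by rewrite flat // actD !shG ?(lt_eqF g00) ?(gt_eqF f00) // addr0 E.
Qed.

End Separation.

(** * Vanishing on trapezoids *)

Section TrapezoidValuation.
Context {R : realType}.
Implicit Types (p q t c d : R).

Lemma lowmx_x0 t c (x : 'cV[R]_2) : 'x_0 (lowmx t c *m x) = 'x_0 x.
Proof. by rewrite mulmx_x0 !mx2E; ring. Qed.

Lemma lowmx_x1 t c (x : 'cV[R]_2) : 'x_1 (lowmx t c *m x) = t * 'x_0 x + c * 'x_1 x.
Proof. by rewrite mulmx_x1 !mx2E. Qed.

Lemma swapmx_x0 (x : 'cV[R]_2) : 'x_0 (swapmx *m x) = 'x_1 x.
Proof. by rewrite mulmx_x0 !mx2E; ring. Qed.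

Lemma swapmx_x1 (x : 'cV[R]_2) : 'x_1 (swapmx *m x) = 'x_0 x.
Proof. by rewrite mulmx_x1 !mx2E; ring. Qed.

Lemma image_mx (phi psi : 'M[R]_2) (P : set 'cV[R]_2) : phi *m psi = 1%:M ->
  (fun x => phi *m x) @` P = [set x | P (psi *m x)].
Proof.
move=> e; have e' := mulmx1C e; apply/seteqP; split=> [_ [x Px <-]|x Px] /=.
  by rewrite mulmxA e' mul1mx.
by exists (psi *m x); rewrite // mulmxA e mul1mx.
Qed.

Lemma lowmxK t c : c != 0 -> lowmx t c *m lowmx (- t / c) c^-1 = 1%:M.
Proof.
move=> c0; rewrite lowmxM; apply: mx2_eq; rewrite !mx2E !mxE //=; first by field.
by rewrite divff.
Qed.

Lemma trap_low p q (f0 f1 g0 g1 : R) t c : 0 < c ->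
  (fun x => lowmx t c *m x) @` trap p q f0 f1 g0 g1 =
  trap p q (c * f0) (t + c * f1) (c * g0) (t + c * g1).
Proof.
move=> c0; rewrite (image_mx _ (lowmxK t (lt0r_neq0 c0))).
apply/seteqP; split=> x; rewrite /trap /= lowmx_x0 lowmx_x1.
  move=> [? ? h1 h2]; split=> //.
    move: h1; rewrite -(ler_pM2l c0) mulrDr [X in _ <= X -> _]mulrDr mulVKf ?gt_eqF //.
    have -> : c * (- t / c * 'x_0 x) = - t * 'x_0 x by field; rewrite gt_eqF.
    lra.
  move: h2; rewrite -(ler_pM2l c0) mulrDr [X in _ <= X -> _]mulrDr mulVKf ?gt_eqF //.
  have -> : c * (- t / c * 'x_0 x) = - t * 'x_0 x by field; rewrite gt_eqF.
  lra.
move=> [? ? h1 h2]; split=> //; rewrite -(ler_pM2l c0) mulrDr [X in _ <= X]mulrDr mulVKf ?gt_eqF //.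
  have -> : c * (- t / c * 'x_0 x) = - t * 'x_0 x by field; rewrite gt_eqF.
  lra.
have -> : c * (- t / c * 'x_0 x) = - t * 'x_0 x by field; rewrite gt_eqF.
lra.
Qed.

Lemma trap_reflect p q (f0 f1 g0 g1 : R) :
  (fun x => lowmx 0 (- 1) *m x) @` trap p q f0 f1 g0 g1 =
  trap p q (- g0) (- g1) (- f0) (- f1).
Proof.
rewrite (image_mx _ (lowmxK 0 (_ : - 1 != 0))) ?oppr_eq0 ?oner_neq0 //.
apply/seteqP; split=> x; rewrite /trap /= lowmx_x0 lowmx_x1 oppr0 mul0r invrN1 => -[? ? ? ?];
  by split=> //; lra.
Qed.

Lemma trap_swap_rect p q c d :
  (fun x => swapmx *m x) @` trap p q c 0 (- d) 0 = trap (- d) c q 0 p 0.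
Proof.
rewrite (image_mx _ swapmxK); apply/seteqP; split=> x; rewrite /trap /= swapmx_x0 swapmx_x1;
  by rewrite !mul0r !addr0 => -[].
Qed.

(** The right triangle with corners (p, 1), (q, 1), (q, 2q/p - 1). Its hypotenuse passes through (p,
    1) and (0, -1), whence the slope 2/p; solved for the abscissa it is p/2 + (p/2) y. *)
Lemma trap_swap_triangle p q : p < 0 ->
  (fun x => swapmx *m x) @` trap p q 1 0 (- 1) (2 / p) =
  trap (2 * q / p - 1) 1 q 0 (p / 2) (p / 2).
Proof.
move=> p0; rewrite (image_mx _ swapmxK).
have pn : p != 0 by rewrite lt_eqF.
have key (x y : R) : (- 1 + 2 / p * x <= y) = (p / 2 + p / 2 * y <= x).
  have hp : 0 < - p / 2 by lra.
  rewrite -(ler_pM2l hp) (_ : - p / 2 * (- 1 + 2 / p * x) = p / 2 - x); last by field.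
  by apply/idP/idP; lra.
apply/seteqP; split=> x; rewrite /trap /= swapmx_x0 swapmx_x1 mul0r addr0 key mul0r addr0.
  move=> [h1 h2 h3 h4]; split=> //.
  have h := h3; rewrite -key in h; apply: le_trans h.
  have ip : p^-1 < 0 by rewrite invr_lt0.
  nra.
move=> [h1 h2 h3 h4]; split=> //.
by apply: le_trans h3; nra.
Qed.

Lemma affine_le p q (h0 h1 k0 k1 x : R) : p < 0 -> 0 < q -> h0 + h1 * p <= k0 + k1 * p ->
  h0 + h1 * q <= k0 + k1 * q -> p <= x -> x <= q -> h0 + h1 * x <= k0 + k1 * x.
Proof.
move=> p0 q0 hp hq px xq; have [t [t0 t1 ->]] := segment_param px xq; nra.
Qed.

Variable mu : set 'cV[R]_2 -> 'M[R]_2.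
Hypothesis mu_val : valuation_on_polyo mu.
Hypothesis mu_con : GL2_contravariant mu.

(** The trapezoids of (f, g) and (f', g') overlap without a gap because g' <= f, which is part of
    the third condition; so their union is the trapezoid of (f', g) and their intersection that of
    (f, g'). *)
Lemma trap_valuation p q (f0 f1 g0 g1 f0' f1' g0' g1' : R) :
  trap_cond p q f0 f1 g0 g1 -> trap_cond p q f0' f1' g0' g1' ->
  trap_cond p q f0 f1 g0' g1' -> trap_cond p q f0' f1' g0 g1 ->
  f0 + f1 * p <= f0' + f1' * p -> f0 + f1 * q <= f0' + f1' * q ->
  g0 + g1 * p <= g0' + g1' * p -> g0 + g1 * q <= g0' + g1' * q ->
  mu (trap p q f0' f1' g0 g1) + mu (trap p q f0 f1 g0' g1') =
  mu (trap p q f0 f1 g0 g1) + mu (trap p q f0' f1' g0' g1').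
Proof.
move=> o1 o2 o3 o4 fp fq gp gq; have [p0 q0 _ _ [kp kq]] := o3.
have U : trap p q f0 f1 g0 g1 `|` trap p q f0' f1' g0' g1' = trap p q f0' f1' g0 g1.
  apply/seteqP; split=> x.
    move=> [[h1 h2 h3 h4]|[h1 h2 h3 h4]]; split=> //.
      by apply: le_trans h4 _; apply: affine_le h1 h2.
    by apply: le_trans h3; apply: affine_le h1 h2.
  move=> [h1 h2 h3 h4]; have [h|h] := leP ('x_1 x) (f0 + f1 * 'x_0 x); first by left.
  right; split=> //; apply: le_trans (ltW h); exact: affine_le h1 h2.
have I : trap p q f0 f1 g0 g1 `&` trap p q f0' f1' g0' g1' = trap p q f0 f1 g0' g1'.
  apply/seteqP; split=> x; first by move=> [[h1 h2 h3 h4] [k1 k2 k3 k4]].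
  move=> [h1 h2 h3 h4]; split; split=> //.
    by apply: le_trans h3; apply: affine_le h1 h2.
  by apply: le_trans h4 _; apply: affine_le h1 h2.
by rewrite -U -I; apply: mu_val; rewrite ?U ?I; apply: trap_polyo.
Qed.

(* The matrix of the map x |-> (x_0, h0 x_1 + h1 x_0) encodes the affine function h0 + h1 x. *)
Definition trap_split p q (G : 'M[R]_2) := forall f0 f1 g0 g1, trap_cond p q f0 f1 g0 g1 ->
  mu (trap p q f0 f1 g0 g1) = act (lowmx f1 f0) G + act (lowmx g1 g0) G.

Lemma trap_split_exists p q : p < 0 -> 0 < q -> exists G, trap_split p q G.
Proof.
move=> p0 q0; apply: (separation p0 q0 (L := fun f0 f1 g0 g1 => mu (trap p q f0 f1 g0 g1))).
- exact: trap_valuation.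
- move=> t c f0 f1 g0 g1 c0 o; rewrite -trap_low // mu_con //; last exact: trap_polyo.
  by rewrite lowmx_unit // gt_eqF.
- move=> f0 f1 g0 g1 o; rewrite -trap_reflect mu_con //; last exact: trap_polyo.
  by rewrite lowmx_unit // oppr_eq0 oner_neq0.
Qed.

Lemma mu_swap P : polyo P -> mu ((fun x => swapmx *m x) @` P) = act swapmx (mu P).
Proof. by move=> oP; rewrite mu_con // swapmx_unit. Qed.

(** Swapping the axes exchanges entries (0, 0) with (1, 1) and (0, 1) with (1, 0). The factors are
    the scaling weights of the two opposite edges, with a relative minus sign off the diagonal
    because the edges lie on opposite sides of the origin. *)
Lemma rect_rel p q c d G H : p < 0 -> 0 < q -> 0 < c -> 0 < d ->
  trap_split p q G -> trap_split (- d) c H ->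
  [/\ G i0 i0 * (c^-1 + d^-1) = H i1 i1 * ((q ^+ 3)^-1 - (p ^+ 3)^-1),
      G i1 i1 * ((c ^+ 3)^-1 + (d ^+ 3)^-1) = H i0 i0 * (q^-1 - p^-1),
      G i0 i1 * ((c ^+ 2)^-1 - (d ^+ 2)^-1) = H i1 i0 * ((q ^+ 2)^-1 - (p ^+ 2)^-1) &
      G i1 i0 * ((c ^+ 2)^-1 - (d ^+ 2)^-1) = H i0 i1 * ((q ^+ 2)^-1 - (p ^+ 2)^-1)].
Proof.
move=> p0 q0 c0 d0 sG sH.
have o1 : trap_cond p q c 0 (- d) 0 by split; rewrite ?oppr_lt0 //; split; lra.
have o2 : trap_cond (- d) c q 0 p 0 by split; rewrite ?oppr_lt0 //; split; lra.
have := mu_swap (trap_polyo o1); rewrite trap_swap_rect sH // sG //.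
have [pn qn cn dn] : [/\ p != 0, q != 0, c != 0 & d != 0] by rewrite lt_eqF // !gt_eqF.
have dn' : - d != 0 by rewrite oppr_eq0.
have [a1 a2 a3 a4] := act_lowE 0 G cn; have [b1 b2 b3 b4] := act_lowE 0 G dn'.
have [c1 c2 c3 c4] := act_lowE 0 H qn; have [d1 d2 d3 d4] := act_lowE 0 H pn.
rewrite gtr0_norm // in a1 a2 a3 a4; rewrite normrN gtr0_norm // in b1 b2 b3 b4.
rewrite gtr0_norm // in c1 c2 c3 c4; rewrite ltr0_norm // in d1 d2 d3 d4.
rewrite act_swapE => /matrixP E.
have D (A B : 'M[R]_2) i j : (A + B) i j = A i j + B i j by rewrite mxE.
have := E i0 i0; have := E i0 i1; have := E i1 i0; have := E i1 i1.
rewrite !mx2E !D a1 a2 a3 a4 b1 b2 b3 b4 c1 c2 c3 c4 d1 d2 d3 d4 !mul0r expr0n /= !mul0r !addr0 !subr0.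
move=> e1 e2 e3 e4; split.
- apply: etrans (_ : G i0 i0 / c + G i0 i0 / d = _); last first.
    by rewrite -e1; field; rewrite ?pn ?qn ?cn ?dn.
  by field; rewrite ?pn ?qn ?cn ?dn.
- apply: etrans (_ : G i1 i1 / c ^+ 2 / c + G i1 i1 / (- d) ^+ 2 / d = _); last first.
    by rewrite -e4; field; rewrite ?pn ?qn ?cn ?dn.
  by field; rewrite ?pn ?qn ?cn ?dn.
- apply: etrans (_ : G i0 i1 / c / c + G i0 i1 / - d / d = _); last first.
    by rewrite -e2; field; rewrite ?pn ?qn ?cn ?dn.
  by field; rewrite ?pn ?qn ?cn ?dn.
- apply: etrans (_ : G i1 i0 / c / c + G i1 i0 / - d / d = _); last first.
    by rewrite -e3; field; rewrite ?pn ?qn ?cn ?dn.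
  by field; rewrite ?pn ?qn ?cn ?dn.
Qed.

(** Compare entry (0, 0) of the triangle with entry (1, 1) of its swapped copy. The latter only
    involves entry (1, 1) of [H] and vanishes; in the former the sloped edge contributes 2/p times
    the sum of the off-diagonal entries of [G]. *)
Lemma triangle_rel p q G H : p < 0 -> 0 < q -> trap_split p q G ->
  trap_split (2 * q / p - 1) 1 H -> G i0 i0 = 0 -> G i1 i1 = 0 -> H i1 i1 = 0 ->
  G i0 i1 + G i1 i0 = 0.
Proof.
move=> p0 q0 sG sH g00 g11 h11.
have ip : p^-1 < 0 by rewrite invr_lt0.
have pn : p != 0 by rewrite lt_eqF.
have n1 : 1 != 0 :> R := oner_neq0 R.
have m1 : - 1 != 0 :> R by rewrite oppr_eq0.
have qp : q / p < 0 by rewrite pmulr_rlt0.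
have o1 : trap_cond p q 1 0 (- 1) (2 / p).
  by split=> //; split; [rewrite divfK //|]; lra.
have o2 : trap_cond (2 * q / p - 1) 1 q 0 (p / 2) (p / 2).
  have e : p / 2 + p / 2 * (2 * q / p - 1) = q by field.
  by split=> //; [lra|lra|split; [rewrite e; lra|lra]].
have := mu_swap (trap_polyo o1); rewrite trap_swap_triangle // sH // sG //.
have [a1 _ _ _] := act_lowE 0 G n1; have [b1 _ _ _] := act_lowE (2 / p) G m1.
have p2 : p / 2 != 0 by rewrite lt_eqF //; lra.
have [_ _ _ c4] := act_lowE 0 H (lt0r_neq0 q0); have [_ _ _ d4] := act_lowE (p / 2) H p2.
rewrite act_swapE => /matrixP/(_ i1 i1); rewrite mx2E.
have D (A B : 'M[R]_2) i j : (A + B) i j = A i j + B i j by rewrite mxE.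
rewrite !D a1 b1 c4 d4 g00 g11 h11 normrN1 normr1 !mul0r addr0 => E.
have : 2 / p * (G i0 i1 + G i1 i0) = 0 by rewrite E; field.
by move/eqP; rewrite mulf_eq0 mulf_eq0 invr_eq0 (negPf pn) pnatr_eq0 => /eqP.
Qed.

Lemma trap_zero : mu (trap (- 1) 1 1 0 (- 1) 0) i0 i0 = 0 ->
  forall p q (f0 f1 g0 g1 : R), trap_cond p q f0 f1 g0 g1 -> mu (trap p q f0 f1 g0 g1) = 0.
Proof.
move=> sq0.
have n1 : (- 1 : R) < 0 by lra.
have [G1 s1] := trap_split_exists n1 ltr01.
have [a b _ _] := rect_rel n1 ltr01 ltr01 ltr01 s1 s1.
have G1_00 : G1 i0 i0 = 0.
  have n1' : - 1 != 0 :> R by rewrite lt_eqF.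
  have os : trap_cond (- 1) 1 1 0 (- 1 : R) 0 by split=> //; split; lra.
  move: sq0; rewrite s1 // mxE.
  have [-> _ _ _] := act_lowE 0 G1 (oner_neq0 R); have [-> _ _ _] := act_lowE 0 G1 n1'.
  rewrite normrN1 normr1 !mul0r expr0n /= mul0r; lra.
have G1_11 : G1 i1 i1 = 0.
  have c3 : (- 1) ^+ 3 = - 1 :> R by ring.
  by move: a; rewrite G1_00 mul0r c3 expr1n invrN1 invr1; lra.
have diag p q G : p < 0 -> 0 < q -> trap_split p q G -> G i0 i0 = 0 /\ G i1 i1 = 0.
  move=> p0 q0 sG; have [+ + _ _] := rect_rel p0 q0 ltr01 ltr01 sG s1.
  by rewrite G1_00 G1_11 !mul0r expr1n invr1; split; lra.
(* For the symmetric square the off-diagonal relations read 0 = 0. The square [-2, 1]^2 has the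
   non-zero factor 1 - 1/4 on both sides, which makes [G2] symmetric; comparison with [G2] then
   makes every G symmetric. *)
have n2 : (- 2 : R) < 0 by lra.
have [G2 s2] := trap_split_exists n2 ltr01.
have p2 : (0 : R) < 2 by lra.
have sym p q G : p < 0 -> 0 < q -> trap_split p q G -> G i0 i1 = G i1 i0.
  have [_ _ + _] := rect_rel n2 ltr01 ltr01 p2 s2 s2.
  rewrite expr1n invr1 sqrrN => e2.
  have e2' : G2 i0 i1 = G2 i1 i0.
    have n4 : 1 - (2 ^+ 2)^-1 != 0 :> R by apply/eqP; lra.
    exact: (mulIf n4).
  move=> p0 q0 sG; have [_ _ + +] := rect_rel p0 q0 ltr01 p2 sG s2.
  by rewrite expr1n invr1 e2' => <- h; lra.
move=> p q f0 f1 g0 g1 o; have [p0 q0 _ _ _] := o.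
have [G sG] := trap_split_exists p0 q0.
have [g00 g11] := diag _ _ _ p0 q0 sG.
have pt : 2 * q / p - 1 < 0.
  by have : q / p < 0; [rewrite pmulr_rlt0 // invr_lt0|lra].
have [H sH] := trap_split_exists pt ltr01.
have [_ h11] := diag _ _ _ pt ltr01 sH.
have := triangle_rel p0 q0 sG sH g00 g11 h11; have := sym _ _ _ p0 q0 sG => e1 e2.
by rewrite sG // (_ : G = 0) ?act0 ?addr0 //; apply: mx2_eq; rewrite mxE //; lra.
Qed.

End TrapezoidValuation.

(** * Cutting polygons *)

Section Slices.
Context {R : realType}.
Implicit Types (x y z a b p : 'cV[R]_2) (s : seq 'cV[R]_2) (P C : set 'cV[R]_2) (c h : R).

Lemma seq_max (l : seq R) : l != [::] -> exists2 m, m \in l & forall u : R, u \in l -> u <= m.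
Proof.
elim: l => // u [|v l] IH _; first by exists u => [|x]; rewrite ?mem_head // inE => /eqP ->.
have [m ml mmax] := IH isT; exists (Num.max u m).
  by rewrite in_cons; case: leP => _; rewrite ?ml ?orbT ?eqxx.
by move=> x; rewrite in_cons le_max => /orP[/eqP ->|/mmax ->]; rewrite ?lexx ?orbT.
Qed.

Lemma seq_min (l : seq R) : l != [::] -> exists2 m, m \in l & forall u : R, u \in l -> m <= u.
Proof.
move=> l0; have [|m ml mmax] := @seq_max [seq - u | u <- l]; first by case: l l0.
move: ml => /mapP[m' ml' mE]; exists m' => // x xl.
by rewrite -lerN2 -mE; apply: mmax; apply: map_f.
Qed.

Lemma halfplane_cvx (u v w : R) : cvx [set x : 'cV[R]_2 | u * 'x_0 x + v * 'x_1 x <= w].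
Proof. by move=> x y t /= hx hy t0 t1; rewrite !mxE; nra. Qed.

Lemma hull_halfplane s (u v w : R) : (forall p, p \in s -> u * 'x_0 p + v * 'x_1 p <= w) ->
  forall x, conv_hull s x -> u * 'x_0 x + v * 'x_1 x <= w.
Proof. by move=> hs; apply: (hull_min (@halfplane_cvx u v w) hs). Qed.

Lemma crossing C a b c : cvx C -> C a -> C b -> 'x_0 a <= c -> c < 'x_0 b ->
  C (pt2 c ((('x_0 b - c) * 'x_1 a + (c - 'x_0 a) * 'x_1 b) / ('x_0 b - 'x_0 a))).
Proof.
move=> cC Ca Cb ac cb; have ab : 0 < 'x_0 b - 'x_0 a by lra.
rewrite (_ : pt2 _ _ = (('x_0 b - c) / ('x_0 b - 'x_0 a)) *: a
   + (1 - ('x_0 b - c) / ('x_0 b - 'x_0 a)) *: b).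
  apply: cC => //; first by apply: divr_ge0; lra.
  by rewrite ler_pdivrMr // mul1r; lra.
by apply: pt2_eq; rewrite !mxE /=; field; rewrite gt_eqF.
Qed.

(** The section by the line x_0 = c has its ends among the finitely many crossings of that line with
    segments from a vertex in [A] (left of the line or on it) to a vertex in [B] (right of it). A
    point left of the line on a segment from a to b lies between a and the crossing of that
    segment. *)
Lemma slice s c : conv_hull s 0 -> 0 < c -> (exists2 p, p \in s & c < 'x_0 p) ->
  exists lo hi, [/\ conv_hull s (pt2 c lo), conv_hull s (pt2 c hi),
    forall v, conv_hull s (pt2 c v) -> lo <= v /\ v <= hi &
    conv_hull s `&` [set x | 'x_0 x <= c] =
    conv_hull ([seq p <- s | 'x_0 p <= c] ++ [:: pt2 c lo; pt2 c hi])].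
Proof.
move=> s0 c0 [b0 b0s cb0].
set A := [seq p <- s | 'x_0 p <= c]; pose B := [seq p <- s | c < 'x_0 p].
have b0B : b0 \in B by rewrite mem_filter cb0.
have BE p : p \in B -> p \in s /\ c < 'x_0 p by rewrite mem_filter => /andP[].
have AE p : p \in A -> p \in s /\ 'x_0 p <= c by rewrite mem_filter => /andP[].
have sAB : conv_hull s `<=` conv_hull (A ++ B).
  by apply: hull_sub => p ps; rewrite mem_cat !mem_filter ps !andbT; case: leP.
have Bc x : conv_hull B x -> c < 'x_0 x.
  apply: (@hull_min _ B [set x | c < 'x_0 x]) => [y z t /= hy hz t0 t1|p /BE[] //].
  rewrite !mxE; have [->|tn] := eqVneq t 0; first by lra.
  have tp : 0 < t * ('x_0 y - c) by rewrite mulr_gt0 ?subr_gt0 // lt_def tn.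
  have t1p : 0 <= (1 - t) * ('x_0 z - c) by rewrite mulr_ge0 // subr_ge0 // ltW.
  lra.
have Ac x : conv_hull A x -> 'x_0 x <= c.
  have H p : p \in A -> 1 * 'x_0 p + 0 * 'x_1 p <= c by move=> /AE[_]; lra.
  by move=> /(hull_halfplane H); lra.
have As : conv_hull A `<=` conv_hull s by apply: hull_sub => p /AE[].
have Bs : conv_hull B `<=` conv_hull s by apply: hull_sub => p /BE[].
pose cr a b := (('x_0 b - c) * 'x_1 a + (c - 'x_0 a) * 'x_1 b) / ('x_0 b - 'x_0 a).
have crs a b : conv_hull A a -> conv_hull B b -> conv_hull s (pt2 c (cr a b)).
  move=> Aa Bb; apply: crossing (@hull_cvx _ s) (As _ Aa) (Bs _ Bb) (Ac _ Aa) (Bc _ Bb).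
pose l := [seq cr a b | a <- A, b <- B].
(* Otherwise the origin would lie in the hull of [B], strictly to the right of the line. *)
have A0 : exists p, p \in A.
  case E : A => [|p A']; last by exists p; rewrite mem_head.
  by have /sAB := s0; rewrite E cat0s => /Bc; rewrite mxE; lra.
have [a0 a0A] := A0.
have l0 : l != [::].
  by apply/eqP => l0; have := allpairs_f cr a0A b0B; rewrite -/l l0.
have [hi + himax] := seq_max l0; have [lo + lomin] := seq_min l0.
move=> /allpairsP[[a1 b1] /= [a1A b1B loE]] /allpairsP[[a2 b2] /= [a2A b2B hiE]].
(* A bound for crossings of vertex segments passes to all points of the two hulls: after clearing
   the denominator it is affine in a for fixed b and affine in b for fixed a, so it is a half-plane
   condition in each variable. The signs [e] = 1 and [e] = -1 serve the upper and the lower end. *)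
have hull_bound (w : R) (e : R) : (forall a b, a \in A -> b \in B -> e * cr a b <= w) ->
    forall a b, conv_hull A a -> conv_hull B b -> e * cr a b <= w.
  have crE a b : 'x_0 a <= c -> c < 'x_0 b -> (e * cr a b <= w) =
     (e * (('x_0 b - c) * 'x_1 a + (c - 'x_0 a) * 'x_1 b) <= w * ('x_0 b - 'x_0 a)).
    by move=> ac cb; rewrite /cr mulrA ler_pdivrMr //; lra.
  move=> H a b Aa Bb.
  have H1 b' : b' \in B -> e * cr a b' <= w.
    move=> b'B; have [_ cb'] := BE _ b'B; rewrite crE //; last exact: Ac.
    have HA p : p \in A ->
        (w - e * 'x_1 b') * 'x_0 p + e * ('x_0 b' - c) * 'x_1 p <= w * 'x_0 b' - e * c * 'x_1 b'.
      by move=> pA; have := H p b' pA b'B; rewrite crE //; [lra|case: (AE _ pA)].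
    by have := hull_halfplane HA Aa; lra.
  have HB p : p \in B ->
      (e * 'x_1 a - w) * 'x_0 p + e * (c - 'x_0 a) * 'x_1 p <= e * c * 'x_1 a - w * 'x_0 a.
    by move=> pB; have := H1 p pB; rewrite crE //; [lra|exact: Ac|case: (BE _ pB)].
  by rewrite crE //; [have := hull_halfplane HB Bb; lra|exact: Ac|exact: Bc].
have cr_lo a b : conv_hull A a -> conv_hull B b -> lo <= cr a b.
  move=> Aa Bb; have := @hull_bound (- lo) (- 1) _ a b Aa Bb.
  rewrite mulN1r lerN2; apply=> a' b' a'A b'B; rewrite mulN1r lerN2; apply: lomin.
  by apply: allpairs_f.
have cr_hi a b : conv_hull A a -> conv_hull B b -> cr a b <= hi.
  move=> Aa Bb; have := @hull_bound hi 1 _ a b Aa Bb.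
  rewrite mul1r; apply=> a' b' a'A b'B; rewrite mul1r; apply: himax.
  by apply: allpairs_f.
have slo : conv_hull s (pt2 c lo) by rewrite loE; apply: crs; apply: hull_mem.
have shi : conv_hull s (pt2 c hi) by rewrite hiE; apply: crs; apply: hull_mem.
have Hc v : conv_hull s (pt2 c v) -> exists a b, [/\ conv_hull A a, conv_hull B b & v = cr a b].
  move=> /sAB/hull_cat[Av|/Bc|[a [b [t [Aa Bb [t0 t1]]]]]].
  - exists (pt2 c v), b0; split=> //; first exact: hull_mem.
    by rewrite /cr pt2_x0 pt2_x1; field; rewrite subr_eq0 gt_eqF.
  - by rewrite pt2_x0 ltxx.
  - move=> e; have := congr1 (fun x : 'cV_2 => 'x_0 x) e; have := congr1 (fun x : 'cV_2 => 'x_1 x) e.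
    rewrite pt2_x0 pt2_x1 !mxE => ve ce; exists a, b; split=> //.
    have ac := Ac _ Aa; have cb := Bc _ Bb; rewrite /cr ve ce.
    by field; rewrite subr_eq0 gt_eqF //; lra.
exists lo, hi; split=> // [v /Hc[a [b [Aa Bb ->]]]|].
  by split; [apply: cr_lo|apply: cr_hi].
set A' := A ++ _.
have AA' : conv_hull A `<=` conv_hull A' by apply: hull_sub => p; rewrite mem_cat => ->.
have A'lo : conv_hull A' (pt2 c lo) by apply: hull_mem; rewrite mem_cat !inE eqxx !orbT.
have A'hi : conv_hull A' (pt2 c hi) by apply: hull_mem; rewrite mem_cat !inE eqxx !orbT.
apply/seteqP; split=> [z [/sAB/hull_cat[Az _|/Bc + zc|[a [b [t [Aa Bb [t0 t1 ->]]]]]]]|z A'z] /=.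
- exact: AA'.
- by move: zc => /=; lra.
- rewrite !mxE => zc; have ac := Ac _ Aa; have cb := Bc _ Bb.
  have w : conv_hull A' (pt2 c (cr a b)).
    by apply: cvx_pt2_segment A'lo A'hi _ _; [exact: hull_cvx|exact: cr_lo|exact: cr_hi].
  have [ac'|ac'] := eqVneq ('x_0 a) c.
    have t1' : t = 1 by apply/eqP; rewrite eq_le t1 /=; nra.
    by rewrite t1' subrr scale1r scale0r addr0; apply: AA'.
  have u0 : 0 < c - 'x_0 a by rewrite subr_gt0 lt_neqAle ac'.
  (* [k] is the fraction of the way from [a] to the crossing point at which the given point lies; it
     is at most 1 because the point is not beyond the line. *)
  set k := (1 - t) * ('x_0 b - 'x_0 a) / (c - 'x_0 a).
  have -> : t *: a + (1 - t) *: b = (1 - k) *: a + (1 - (1 - k)) *: pt2 c (cr a b).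
    apply: pt2_eq; rewrite !mxE /=.
      by rewrite /k; field; rewrite gt_eqF.
    by rewrite /k /cr; field; rewrite !gt_eqF //; lra.
  have k1 : k <= 1 by rewrite ler_pdivrMr // mul1r; lra.
  have k0 : 0 <= k by apply: divr_ge0 (ltW u0); apply: mulr_ge0; lra.
  by apply: hull_cvx => //; [exact: AA'|lra|lra].
have A's : conv_hull A' `<=` conv_hull s.
  apply: hull_min => [|p]; first exact: hull_cvx.
  rewrite mem_cat !inE => /orP[/AE[ps _]|/orP[]/eqP -> //]; exact: hull_mem.
split; first exact: A's.
have H p : p \in A' -> 1 * 'x_0 p + 0 * 'x_1 p <= c.
  by rewrite mem_cat !inE => /orP[/AE[_]|/orP[]/eqP ->]; rewrite ?pt2_x0; lra.
by have := hull_halfplane H A'z; lra.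
Qed.

End Slices.

(** * Removing caps from a polygon *)

Section Cutting.
Context {R : realType}.
Implicit Types (p : 'cV[R]_2) (s : seq 'cV[R]_2) (P : set 'cV[R]_2) (c h : R).

Lemma boxin_halfplane c : 0 < c -> boxin [set x : 'cV[R]_2 | 'x_0 x <= c].
Proof.
move=> c0; exists c; split=> // a b; rewrite ltr_norml => /andP[_ ac] _ /=.
by rewrite pt2_x0 ltW.
Qed.

Lemma boxin0 P : boxin P -> P 0.
Proof.
move=> [e [e0 eP]]; rewrite (pt2_eta 0) !mxE; apply: eP; rewrite normr0 //.
Qed.

Lemma polyo_cut P c : polyo P -> 0 < c -> polyo (P `&` [set x | 'x_0 x <= c]).
Proof.
move=> oP c0; have /polyoP[[s sP] bP] := oP.
apply/polyoP; split; last exact: boxinI (boxin_halfplane c0).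
have [[p ps cp]|nex] := pselect (exists2 p, p \in s & c < 'x_0 p).
  have s0 : conv_hull s 0 by rewrite -sP; apply: boxin0.
  have [lo [hi [_ _ _ E]]] := slice s0 c0 (ex_intro2 _ _ p ps cp).
  by eexists; rewrite sP E.
exists s; rewrite sP; apply/seteqP; split=> [x []//|x xs]; split=> //=.
have H p : p \in s -> 1 * 'x_0 p + 0 * 'x_1 p <= c.
  by move=> ps; have [//|cp] := leP ('x_0 p) c; [lra|case: nex; exists p].
by have := hull_halfplane H xs; lra.
Qed.

Variable mu : set 'cV[R]_2 -> 'M[R]_2.
Hypothesis mu_val : valuation_on_polyo mu.
Hypothesis mu_trap : forall a b f0 f1 g0 g1 : R, trap_cond a b f0 f1 g0 g1 ->
  mu (trap a b f0 f1 g0 g1) = 0.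

(* If no vertex lies strictly between the lines x = c and x = h, the cap of P
   beyond x = c is a trapezoid; prolonging its two legs to the left of P gives
   trapezoids K and D with K `|` P = D. *)
Lemma cap s c h lo hi : polyo (conv_hull s) -> 0 < c -> c < h ->
  (forall p, p \in s -> 'x_0 p <= c \/ 'x_0 p = h) -> (exists2 p, p \in s & 'x_0 p = h) ->
  conv_hull s (pt2 c lo) -> conv_hull s (pt2 c hi) ->
  (forall v, conv_hull s (pt2 c v) -> lo <= v /\ v <= hi) ->
  mu (conv_hull s) = mu (conv_hull s `&` [set x | 'x_0 x <= c]).
Proof.
move=> os c0 ch sch [ph phs phh] slo shi slice_c.
have cs : cvx (conv_hull s) := @hull_cvx _ s.
have /polyoP[_ [e [e0 es]]] := os.
pose tops := [seq 'x_1 p | p <- s & 'x_0 p == h].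
have top_in p : p \in s -> 'x_0 p = h -> 'x_1 p \in tops.
  by move=> ps pe; apply: map_f; rewrite mem_filter pe eqxx.
have tops0 : tops != [::] by apply/eqP => t0; have := top_in _ phs phh; rewrite t0.
have topE v : v \in tops -> conv_hull s (pt2 h v).
  move=> /mapP[p]; rewrite mem_filter => /andP[/eqP <- ps] ->.
  by rewrite -pt2_eta; apply: hull_mem.
have [T /topE sT maxT] := seq_max tops0; have [B /topE sB minB] := seq_min tops0.
have BT : B <= T.
  by have := maxT _ (top_in _ phs phh); have := minB _ (top_in _ phs phh); lra.
have [m + minm] : exists2 m, m \in [seq 'x_0 p | p <- s] &
    forall u : R, u \in [seq 'x_0 p | p <- s] -> m <= u.
  by apply: seq_min; case: (s) phs.
move=> /mapP[pm pms mE].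
have hc : 0 < h - c by rewrite subr_gt0.
have hcn : h - c != 0 by rewrite gt_eqF.
(* The legs of the cap: f joins (c, hi) to (h, T), and g joins (c, lo) to (h, B). *)
pose f1 := (T - hi) / (h - c); pose f0 := hi - f1 * c.
pose g1 := (B - lo) / (h - c); pose g0 := lo - g1 * c.
have fc : f0 + f1 * c = hi by rewrite /f0 subrK.
have gc : g0 + g1 * c = lo by rewrite /g0 subrK.
have fh : f0 + f1 * h = T by rewrite /f0 /f1; field.
have gh : g0 + g1 * h = B by rewrite /g0 /g1; field.
have lohi : lo <= hi by have [] := slice_c _ slo.
(* The segment from a vertex left of the cut to (h, T) meets the line x_0 = c inside the polygon,
   hence at height at most [hi]; so the vertex cannot lie above the prolonged leg. The lower leg is
   symmetric. *)
have belowf p : p \in s -> (- f1) * 'x_0 p + 1 * 'x_1 p <= f0.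
  move=> ps; have [pc|pe] := sch _ ps; last first.
    by have := maxT _ (top_in _ ps pe); rewrite -fh pe; lra.
  have := crossing cs (hull_mem ps) sT pc; rewrite !pt2_x0 !pt2_x1.
  move=> /(_ ch)/slice_c[_]; rewrite ler_pdivrMr -?fc -?fh; last by lra.
  by move=> H; rewrite -(ler_pM2l hc); lra.
have aboveg p : p \in s -> g1 * 'x_0 p + (- 1) * 'x_1 p <= - g0.
  move=> ps; have [pc|pe] := sch _ ps; last first.
    by have := minB _ (top_in _ ps pe); rewrite -gh pe; lra.
  have := crossing cs (hull_mem ps) sB pc; rewrite !pt2_x0 !pt2_x1.
  move=> /(_ ch)/slice_c[+ _]; rewrite ler_pdivlMr -?gc -?gh; last by lra.
  by move=> H; rewrite -(ler_pM2l hc); lra.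
have leftm p : p \in s -> (- 1) * 'x_0 p + 0 * 'x_1 p <= - m.
  by move=> ps; have := minm _ (map_f _ ps); lra.
have righth p : p \in s -> 1 * 'x_0 p + 0 * 'x_1 p <= h.
  by move=> ps; have [|] := sch _ ps; lra.
have e2 : `|e / 2| < e by rewrite gtr0_norm; lra.
have e2' : `|- (e / 2)| < e by rewrite normrN.
have z0 : `|0 : R| < e by rewrite normr0.
have m0 : m < 0.
  by have := hull_halfplane leftm (es _ _ e2' z0); rewrite pt2_x0; lra.
have f00 : 0 < f0.
  by have := hull_halfplane belowf (es _ _ z0 e2); rewrite pt2_x0 pt2_x1; lra.
have g00 : g0 < 0.
  by have := hull_halfplane aboveg (es _ _ z0 e2'); rewrite pt2_x0 pt2_x1; lra.
(* The prolonged legs have not crossed before reaching the left end [m], since a vertex at abscissa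
   [m] lies between them. *)
have gfm : g0 + g1 * m <= f0 + f1 * m.
  by have := belowf _ pms; have := aboveg _ pms; rewrite -mE; lra.
have oK : trap_cond m c f0 f1 g0 g1 by split=> //; split=> //; rewrite fc gc.
have oD : trap_cond m h f0 f1 g0 g1.
  by split=> //; [exact: lt_trans ch|split=> //; rewrite fh gh].
have inside x : conv_hull s x -> trap m h f0 f1 g0 g1 x.
  move=> xs; have := hull_halfplane belowf xs; have := hull_halfplane aboveg xs.
  have := hull_halfplane leftm xs; have := hull_halfplane righth xs.
  by split; lra.
have U : trap m c f0 f1 g0 g1 `|` conv_hull s = trap m h f0 f1 g0 g1.
  apply/seteqP; split=> [x [[h1 h2 h3 h4]|/inside //]|x [h1 h2 h3 h4]].
    by split=> //; apply: le_trans (ltW ch).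
  have [xc|cx] := leP ('x_0 x) c; first by left.
  right; have : trap c h f0 f1 g0 g1 x by split=> //; exact: ltW.
  by apply: trap_sub_cvx; rewrite ?fc ?gc ?fh ?gh // ltW.
have I : trap m c f0 f1 g0 g1 `&` conv_hull s = conv_hull s `&` [set x | 'x_0 x <= c].
  apply/seteqP; split=> [x [[h1 h2 h3 h4] //]|x [xs xc]]; split=> //.
  by have [h1 h2 h3 h4] := inside _ xs.
have := mu_val (trap_polyo oK) os; rewrite U I (mu_trap oK) (mu_trap oD) !add0r => <- //.
- exact: trap_polyo.
- exact: polyo_cut.
Qed.

(** Induction on the number of levels (abscissae) beyond [c], not on the number of vertices: a cut
    removes one level but may replace a single vertex by two new ones. *)
Lemma cut_right n (hs : seq R) s c : (size hs <= n)%N -> polyo (conv_hull s) -> 0 < c ->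
  (forall p, p \in s -> 'x_0 p <= c \/ 'x_0 p \in hs) ->
  mu (conv_hull s) = mu (conv_hull s `&` [set x | 'x_0 x <= c]).
Proof.
have triv s' c' : (forall p, p \in s' -> 'x_0 p <= c') ->
    conv_hull s' = conv_hull s' `&` [set x | 'x_0 x <= c'].
  move=> H; apply/seteqP; split=> [x xs|x []//]; split=> //=.
  have H' p : p \in s' -> 1 * 'x_0 p + 0 * 'x_1 p <= c' by move=> /H; lra.
  by have := hull_halfplane H' xs; lra.
elim: n hs s c => [|n IH] hs s c hn os c0 H.
  by rewrite -triv // => p /H[//|]; move: hn; rewrite leqn0 size_eq0 => /eqP ->.
have [hs0|hs0] := eqVneq hs [::]; first by rewrite -triv // => p /H[//|]; rewrite hs0.
have [h hhs hmax] := seq_max hs0.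
have [hc|ch] := leP h c.
  by rewrite -triv // => p /H[//|/hmax ph]; apply: le_trans ph hc.
pose hs' := [seq u <- hs | u != h].
have hn' : (size hs' <= n)%N.
  rewrite -ltnS; apply: leq_trans hn; rewrite size_filter ltn_neqAle count_size andbT -all_count.
  by apply/negP => /allP/(_ h hhs); rewrite eqxx.
(* The cut is made at the next level below [h], or at [c] if none is left. No vertex lies strictly
   between [c'] and [h], as [cap] requires, and the two new vertices have abscissa [c'], so they
   create no new level. *)
have [//|c' c'in c'max] := @seq_max _ (c :: hs').
have cc' : c <= c' by apply: c'max; rewrite mem_head.
have c'0 : 0 < c' by apply: lt_le_trans cc'.
have c'h : c' < h.
  move: c'in; rewrite in_cons => /orP[/eqP -> //|].
  by rewrite mem_filter lt_neqAle => /andP[-> /hmax ->].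
have H' p : p \in s -> 'x_0 p <= c' \/ 'x_0 p = h.
  move=> /H[pc|phs]; first by left; apply: le_trans cc'.
  have [->|ph] := eqVneq ('x_0 p) h; first by right.
  by left; apply: c'max; rewrite in_cons mem_filter ph phs orbT.
have [[p ps cp]|nex] := pselect (exists2 p, p \in s & c' < 'x_0 p); last first.
  apply: (IH hs') => // p ps; have [|phs] := H _ ps; first by left.
  right; rewrite mem_filter phs andbT; apply/eqP => ph.
  by apply: nex; exists p => //; rewrite ph.
have pe : 'x_0 p = h by have [|//] := H' _ ps; lra.
have s0 : conv_hull s 0 by have /polyoP[_ /boxin0] := os.
have [lo [hi [slo shi sl E]]] := slice s0 c'0 (ex_intro2 _ _ p ps cp).
rewrite (cap os c'0 c'h H' _ slo shi sl); last by exists p.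
have oE := polyo_cut os c'0.
have -> : conv_hull s `&` [set x | 'x_0 x <= c] =
   conv_hull s `&` [set x | 'x_0 x <= c'] `&` [set x | 'x_0 x <= c].
  apply/seteqP; split=> [x /= [xs xc]|x /= [[xs _] xc]]; split=> //=.
  by split=> //; apply: le_trans xc cc'.
rewrite E in oE *; apply: (IH hs') => // r; rewrite mem_cat mem_filter => /orP[/andP[rc rs]|].
  have [|rhs] := H _ rs; first by left.
  right; rewrite mem_filter rhs andbT; apply/eqP => rh.
  by move: rc; rewrite rh; lra.
have c'P : c' <= c \/ c' \in hs'.
  by move: c'in; rewrite in_cons => /orP[/eqP ->|]; [left|right].
by rewrite !inE => /orP[]/eqP ->; rewrite pt2_x0.
Qed.

Hypothesis mu_con : GL2_contravariant mu.

Lemma act_inj (phi A B : 'M[R]_2) : phi \in unitmx -> act phi A = act phi B -> A = B.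
Proof.
move=> u e; have u' : invmx phi \in unitmx by rewrite unitmx_inv.
have K C : act (invmx phi) (act phi C) = C.
  by rewrite -actM // mulVmx // /act invmx1 trmx1 mul1mx mulmx1 det1 normr1 invr1 scale1r.
by rewrite -[A]K e K.
Qed.

(** Contravariance transports the vertical cut to an arbitrary direction: the polygon is moved by
    [phi], cut, and moved back, the action on values being injective. *)
Lemma mu_cut (phi : 'M[R]_2) P c : phi \in unitmx -> polyo P -> 0 < c ->
  polyo (P `&` [set x | 'x_0 (phi *m x) <= c]) /\
  mu P = mu (P `&` [set x | 'x_0 (phi *m x) <= c]).
Proof.
move=> u oP c0; have oI := polyo_lin u oP.
set Q := P `&` _.
have QE : (fun x => phi *m x) @` Q = (fun x => phi *m x) @` P `&` [set x | 'x_0 x <= c].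
  apply/seteqP; split=> [_ [x [xP xc] <-]|_ [[x xP <-] xc]]; first by split=> //; exists x.
  by exists x.
have oQI := polyo_cut oI c0; rewrite -QE in oQI.
have oQ : polyo Q.
  have u' : invmx phi \in unitmx by rewrite unitmx_inv.
  have := polyo_lin u' oQI; congr polyo.
  apply/seteqP; split=> [_ [_ [x Qx <-] <-]|x Qx] /=; first by rewrite mulKmx.
  by exists (phi *m x); [exists x|rewrite mulKmx].
split=> //; apply: (act_inj u).
rewrite -[LHS](mu_con u oP) -[RHS](mu_con u oQ) QE.
have /polyoP[[s sE] _] := oI.
rewrite sE; rewrite sE in oI.
by apply: (@cut_right _ [seq 'x_0 p | p <- s]) => // p ps; right; apply: map_f.
Qed.

Lemma polyo_zero P : polyo P -> mu P = 0.
Proof.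
move=> oP; have /polyoP[_ [e [e0 eP]]] := oP.
(* Half of [e], so that the closed square of half-side [c] lies in the open square contained in [P];
   the four half-planes x_0, -x_0, x_1, -x_1 <= c then cut [P] down to exactly this square. *)
pose c := e / 2; have c0 : 0 < c by rewrite divr_gt0.
have unit_of (a b a' b' : R) : a * b' - b * a' != 0 -> mx2 a b a' b' \in unitmx.
  by move=> h; rewrite unitmxE det_mx2 !mx2E unitfE.
have u1 : mx2 (1 : R) 0 0 1 \in unitmx by apply: unit_of; rewrite mulr1 mulr0 subr0 oner_neq0.
have u2 : mx2 (- 1 : R) 0 0 1 \in unitmx.
  by apply: unit_of; rewrite mulr1 mulr0 subr0 oppr_eq0 oner_neq0.
have u3 : mx2 (0 : R) 1 1 0 \in unitmx.
  by apply: unit_of; rewrite mulr1 mulr0 sub0r oppr_eq0 oner_neq0.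
have u4 : mx2 (0 : R) (- 1) 1 0 \in unitmx.
  by apply: unit_of; rewrite mulr1 mulr0 sub0r opprK oner_neq0.
have [po1 e1] := mu_cut u1 oP c0; have [po2 e2] := mu_cut u2 po1 c0.
have [po3 e3] := mu_cut u3 po2 c0; have [po4 e4] := mu_cut u4 po3 c0.
rewrite e1 e2 e3 e4.
set Q := (X in mu X).
have -> : Q = trap (- c) c c 0 (- c) 0.
  apply/seteqP; split=> x.
    move=> [[[[_ a1] a2] a3] a4]; move: a1 a2 a3 a4.
    by rewrite /= !mulmx_x0 !mx2E => *; split; lra.
  move=> [h1 h2 h3 h4]; have Px : P x.
    rewrite (pt2_eta x); apply: eP; rewrite ltr_norml; apply/andP; rewrite /c in h1 h2 h3 h4 *; split; lra.
  by split; [split; [split; [split=> //|]|]|]; rewrite /= mulmx_x0 !mx2E; lra.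
by apply: mu_trap; split; rewrite ?oppr_lt0 //; split; lra.
Qed.

End Cutting.

(** * Planar Lebesgue measure under linear maps *)

Section PlanarLebesgue.
Context {R : realType}.
Local Notation leb := (@lebesgue_measure R).
Local Notation RT := (measurableTypeR R).
Implicit Types (t c b : R).

Definition affine b c (y : RT) : RT := b + c * y.

Lemma measurable_affine b c : measurable_fun [set: RT] (affine b c).
Proof. by apply: measurable_funD => //; apply: measurable_funM. Qed.

Lemma affine_preimage_itv_gt0 b c u v : 0 < c ->
  affine b c @^-1` `]u, v]%classic = `](u - b) / c, (v - b) / c]%classic.
Proof.
move=> c0; apply/seteqP; split=> y; rewrite /affine /= !in_itv /= ltr_pdivrMr // ler_pdivlMr // => /andP[? ?];
  by apply/andP; split; lra.
Qed.

Lemma affine_preimage_itv_lt0 b c u v : c < 0 ->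
  affine b c @^-1` `]u, v]%classic = `[(v - b) / c, (u - b) / c[%classic.
Proof.
move=> c0; apply/seteqP; split=> y; rewrite /affine /= !in_itv /= ltr_ndivlMr // ler_ndivrMr // => /andP[? ?];
  by apply/andP; split; lra.
Qed.

(** By uniqueness of Lebesgue measure it suffices to test half-open intervals. For negative [c] the
    preimage is closed at the other end, which has the same length. *)
Lemma lebesgue_affine b c (A : set RT) : c != 0 -> measurable A ->
  leb A = (`|c|%:E * leb (affine b c @^-1` A))%E.
Proof.
move=> cn mA.
have mf := measurable_affine b c.
pose m' : {measure set RT -> \bar R} := mscale (NngNum (normr_ge0 c)) (pushforward leb (affine b c)).
rewrite (@lebesgue_measure_unique R (m' mf)) // => X /ocitvP[->|[[u v] /= uv ->]].
  by rewrite !measure0.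
rewrite /m' /= /mscale /= /pushforward.
have cp : 0 < `|c| by rewrite normr_gt0.
have [c0|c0|/eqP] := ltgtP c 0; last by rewrite (negPf cn).
- rewrite affine_preimage_itv_lt0 // !lebesgue_measure_itv /= !lte_fin uv.
  rewrite ltr_nM2r ?invr_lt0 // ltrD2r uv -!EFinB -EFinM; congr EFin.
  by rewrite ltr0_norm //; field.
- rewrite affine_preimage_itv_gt0 // !lebesgue_measure_itv /= !lte_fin uv.
  rewrite ltr_pM2r ?invr_gt0 // ltrD2r uv -!EFinB -EFinM; congr EFin.
  by rewrite gtr0_norm //; field.
Qed.

(** The product measure occurring in [moment2], named so that a measure structure can be attached to
    it. *)
Definition lebesgue2 : set (RT * RT) -> \bar R := (leb \x leb)%E.
HB.instance Definition _ := Measure.on lebesgue2.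

Definition lowfun t c (z : RT * RT) : RT * RT := (z.1, affine (t * z.1) c z.2).

Definition swapfun (z : RT * RT) : RT * RT := (z.2, z.1).

Lemma measurable_lowfun t c : measurable_fun [set: RT * RT] (lowfun t c).
Proof.
apply/measurable_fun_pairP; split => /=; first exact: measurable_fst.
by apply: measurable_funD; apply: measurable_funM.
Qed.

Lemma measurable_swapfun : measurable_fun [set: RT * RT] swapfun.
Proof.
by apply/measurable_fun_pairP; split => /=; [exact: measurable_snd|exact: measurable_fst].
Qed.

Lemma lebesgue2_swap (X : set (RT * RT)) : measurable X ->
  lebesgue2 X = (1%:E * lebesgue2 (swapfun @^-1` X))%E.
Proof.
move=> mX; rewrite mul1e.
pose m' : {measure set (RT * RT) -> \bar R} := pushforward lebesgue2 swapfun.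
apply: (@product_measure_unique _ _ RT RT R leb leb (m' measurable_swapfun)) mX => A B mA mB.
rewrite /m' /= /pushforward (_ : swapfun @^-1` _ = B `*` A); last first.
  by apply/seteqP; split=> z /= [].
by rewrite /lebesgue2 product_measure1E // muleC.
Qed.

(** Tested on measurable rectangles: over each abscissa x in [A] the fibre of the preimage is the
    preimage of [B] under the affine map with translation t x and factor c, so each fibre scales by
    the same |c|. *)
Lemma lebesgue2_low t c (X : set (RT * RT)) : c != 0 -> measurable X ->
  lebesgue2 X = (`|c|%:E * lebesgue2 (lowfun t c @^-1` X))%E.
Proof.
move=> c0 mX.
pose m' : {measure set (RT * RT) -> \bar R} :=
  mscale (NngNum (normr_ge0 c)) (pushforward lebesgue2 (lowfun t c)).
apply: (@product_measure_unique _ _ RT RT R leb leb (m' (@measurable_lowfun t c))) mX => A B mA mB.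
rewrite /m' /= /mscale /= /pushforward /lebesgue2 /product_measure1 /=.
have mAB x : measurable (affine (t * x) c @^-1` B).
  by rewrite -[X in measurable X]setTI; apply: measurable_affine.
rewrite (_ : (fun x => _) = (cst (`|c|^-1%:E * leb B)%E) \_ A).
  rewrite -integral_mkcond integral_cst // muleA muleA -EFinM divff ?normr_eq0 //.
  by rewrite mul1e muleC.
apply/funext => x; rewrite patchE /=; case: ifPn => [/set_mem xA|/negP xA].
  rewrite (lebesgue_affine (t * x) c0 mB) muleA -EFinM mulVf ?normr_eq0 // mul1e.
  congr leb; apply/seteqP; split=> y /=; rewrite /xsection /= inE /=; first by case.
  by [].
rewrite (_ : xsection _ _ = set0) ?measure0 //.
apply/seteqP; split=> y //=; rewrite /xsection /= inE /= => -[xA' _].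
by apply: xA; rewrite inE.
Qed.

(** From a law for measures of sets to a law for integrals: the image-measure formula handles the
    positive and negative parts of [f], and integrability makes both finite, so that they may be
    subtracted. *)
Lemma integral_change (F : RT * RT -> RT * RT) (k : R) (D : set (RT * RT)) (f : RT * RT -> R) :
  measurable_fun setT F -> 0 <= k ->
  (forall X, measurable X -> lebesgue2 X = (k%:E * lebesgue2 (F @^-1` X))%E) ->
  measurable D -> measurable_fun setT f ->
  lebesgue2.-integrable (F @^-1` D) (EFin \o (f \o F)) ->
  (\int[lebesgue2]_(z in D) f z = k * \int[lebesgue2]_(z in F @^-1` D) f (F z))%R.
Proof.
move=> mF k0 law mD mf fint.
pose pm : {measure set (RT * RT) -> \bar R} := pushforward lebesgue2 F.
have ge0 (g : RT * RT -> \bar R) : measurable_fun setT g -> (forall z, 0 <= g z)%E ->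
    (\int[lebesgue2]_(z in D) g z = k%:E * \int[lebesgue2]_(z in F @^-1` D) g (F z))%E.
  move=> mg g0.
  have E0 := @eq_measure_integral _ _ R D (mscale (NngNum k0) (pm mF)) lebesgue2 g
    (fun A mA _ => law A mA).
  have mgD : measurable_fun D g by exact: measurable_funTS.
  have E1 := @ge0_integral_mscale _ _ R (pm mF) D mD (NngNum k0) g mgD (fun z _ => g0 z).
  have E2 := @ge0_integral_pushforward _ _ _ _ R F mF lebesgue2 D g mD mgD (fun z _ => g0 z).
  apply: (etrans E0); apply: (etrans E1).
  exact: (congr1 (fun x => (k%:E * x)%E) E2).
rewrite /Rintegral integralE ge0 //; last exact/measurable_funepos/measurable_EFinP.
rewrite ge0 //; last exact/measurable_funeneg/measurable_EFinP.
have mD' : measurable (F @^-1` D) by rewrite -[X in measurable X]setTI; exact: mF.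
set a := (X in (k%:E * X - _)%E); set b := (X in (_ - k%:E * X)%E).
have fF : EFin \o (f \o F) = (EFin \o f) \o F by [].
have pos : a \is a fin_num.
  by have := integrable_pos_fin_num mD' fint; rewrite fF funepos_comp.
have neg : b \is a fin_num.
  by have := integrable_neg_fin_num mD' fint; rewrite fF funeneg_comp.
rewrite -muleBr //; last by rewrite fin_num_adde_defr.
rewrite fineM //; last by rewrite fin_numB pos neg.
congr (k * fine _); rewrite [RHS]integralE -/(EFin \o (f \o F)) fF.
by rewrite funepos_comp funeneg_comp.
Qed.

End PlanarLebesgue.

(** * Moment matrices of polar polygons *)

Section Moments.
Context {R : realType}.
Local Notation leb := (@lebesgue_measure R).
Local Notation RT := (measurableTypeR R).
Local Notation leb2 := (@lebesgue2 R).
Implicit Types (D : set (RT * RT)) (P K L : set 'cV[R]_2).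

Definition mono (i j : 'I_2) (z : RT * RT) : R := pt2 z.1 z.2 i ord0 * pt2 z.1 z.2 j ord0.

Definition coords P : set (RT * RT) := [set z | P (pt2 z.1 z.2)].

Definition mom D : 'M[R]_2 := \matrix_(i < 2, j < 2) \int[leb2]_(z in D) mono i j z.

Lemma moment2E P : moment2 P = mom (coords P).
Proof. by apply/matrixP => i j; rewrite !mxE. Qed.

Definition tame D := measurable D /\ exists M : R, forall z, D z -> `|z.1| <= M /\ `|z.2| <= M.

Lemma measurable_mono i j D : measurable_fun D (mono i j).
Proof.
apply: measurable_funTS; have mc (l : 'I_2) : measurable_fun [set: RT * RT] (fun z : RT * RT => pt2 z.1 z.2 l ord0).
  case: (unliftP ord0 l) => [l' ->|->].
    rewrite (ord1 l') (_ : (fun z => _) = snd); first exact: measurable_snd.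
    by apply/funext => z; rewrite pt2_x1.
  rewrite (_ : (fun z => _) = fst); first exact: measurable_fst.
  by apply/funext => z; rewrite pt2_x0.
exact: measurable_funM.
Qed.

Lemma pt2_norm_le (M a b : R) i : `|a| <= M -> `|b| <= M -> `|pt2 a b i ord0| <= M.
Proof.
move=> aM bM; case: (unliftP ord0 i) => [l ->|->]; last by rewrite pt2_x0.
by rewrite (ord1 l) pt2_x1.
Qed.

Lemma tame_finite D : tame D -> (leb2 D < +oo)%E.
Proof.
move=> [mD [M DM]].
apply: (@le_lt_trans _ _ (leb2 (`[- M, M]%classic `*` `[- M, M]%classic))).
  apply: le_measure; rewrite ?inE //.
    by apply: measurableX; exact: measurable_itv.
  by move=> z /DM[z1 z2]; split; rewrite /= in_itv /= -ler_norml.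
rewrite /lebesgue2 product_measure1E; [|exact: measurable_itv..].
by rewrite /= !lebesgue_measure_itv /=; case: ifP => _; rewrite ?mule0 ?ltry // -EFinB -EFinM ltry.
Qed.

Lemma mono_integrable i j D : tame D -> leb2.-integrable D (EFin \o mono i j).
Proof.
move=> tD; have [mD [M DM]] := tD.
apply: measurable_bounded_integrable => //; first exact: tame_finite.
  exact: measurable_mono.
exists (M * M); split; first exact: num_real.
move=> N MN z /DM[z1 z2]; apply: le_trans (ltW MN); rewrite /mono normrM.
by apply: ler_pM => //; apply: pt2_norm_le.
Qed.

Lemma Rintegral_lin D (a b : R) (f g : RT * RT -> R) : measurable D ->
  leb2.-integrable D (EFin \o f) -> leb2.-integrable D (EFin \o g) ->
  \int[leb2]_(z in D) (a * f z + b * g z) =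
  a * \int[leb2]_(z in D) f z + b * \int[leb2]_(z in D) g z /\
  leb2.-integrable D (EFin \o (fun z => a * f z + b * g z)).
Proof.
move=> mD fi gi.
have Zi c h : leb2.-integrable D (EFin \o h) -> leb2.-integrable D (EFin \o (fun z => c * h z)).
  by move=> hi; apply: (integrableZl mD c hi).
split; last by apply: (integrableD mD (Zi a f fi) (Zi b g gi)).
by rewrite RintegralD //; [rewrite !RintegralZl|exact: Zi|exact: Zi].
Qed.

Lemma mom_change (A : 'M[R]_2) (F : RT * RT -> RT * RT) (k : R) D :
  (forall z, pt2 (F z).1 (F z).2 = A *m pt2 z.1 z.2) ->
  measurable_fun setT F -> 0 <= k ->
  (forall X, measurable X -> leb2 X = (k%:E * leb2 (F @^-1` X))%E) ->
  tame D -> tame (F @^-1` D) ->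
  mom D = k *: (A *m mom (F @^-1` D) *m A^T).
Proof.
move=> FA mF k0 law tD tD'; apply/matrixP => i j.
have mI l m := mono_integrable l m tD'; have mD' := tD'.1.
have [e1 h1] := Rintegral_lin (A i ord0 * A j ord0) (A i ord0 * A j (lift ord0 ord0)) mD'
  (mI ord0 ord0) (mI ord0 (lift ord0 ord0)).
have [e2 h2] := Rintegral_lin (A i (lift ord0 ord0) * A j ord0)
  (A i (lift ord0 ord0) * A j (lift ord0 ord0)) mD'
  (mI (lift ord0 ord0) ord0) (mI (lift ord0 ord0) (lift ord0 ord0)).
have [e3 h3] := Rintegral_lin 1 1 mD' h1 h2.
have E : mono i j \o F = fun z => 1 * (A i ord0 * A j ord0 * mono ord0 ord0 z
     + A i ord0 * A j (lift ord0 ord0) * mono ord0 (lift ord0 ord0) z)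
   + 1 * (A i (lift ord0 ord0) * A j ord0 * mono (lift ord0 ord0) ord0 z
     + A i (lift ord0 ord0) * A j (lift ord0 ord0) * mono (lift ord0 ord0) (lift ord0 ord0) z).
  apply/funext => z; rewrite /mono /= FA.
  have mE l : (A *m pt2 z.1 z.2) l ord0 = A l ord0 * 'x_0 (pt2 z.1 z.2)
      + A l (lift ord0 ord0) * 'x_1 (pt2 z.1 z.2).
    by rewrite mxE !big_ord_recl big_ord0 addr0.
  by rewrite !mE; ring.
rewrite [LHS]mxE (integral_change mF k0 law tD.1); first last.
- by rewrite E.
- exact: measurable_mono.
rewrite [RHS]mxE; congr (k * _).
rewrite (_ : (fun z => mono i j (F z)) = mono i j \o F) // E e3 e1 e2.
by rewrite !mulmx2E !mxE; ring.
Qed.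

End Moments.

(** * Contravariance and valuation property of the polar moment matrix *)

Section PolarMoments.
Context {R : realType}.
Local Notation RT := (measurableTypeR R).
Local Notation leb2 := (@lebesgue2 R).
Implicit Types (P K L : set 'cV[R]_2) (x y : 'cV[R]_2) (phi psi : 'M[R]_2).

Lemma dotE x y : (y^T *m x) ord0 ord0 = 'x_0 y * 'x_0 x + 'x_1 y * 'x_1 x.
Proof. by rewrite !mxE !big_ord_recl big_ord0 addr0 !mxE. Qed.

Lemma polarE P y : polar P y <-> forall x, P x -> 'x_0 y * 'x_0 x + 'x_1 y * 'x_1 x <= 1.
Proof. by split=> H x /H; rewrite dotE. Qed.

Lemma polar_hull s y :
  polar (conv_hull s) y <-> forall p, p \in s -> 'x_0 y * 'x_0 p + 'x_1 y * 'x_1 p <= 1.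
Proof.
rewrite polarE; split=> [H p /hull_mem/H //|H x xs].
exact: hull_halfplane H _ xs.
Qed.

(** The polar is a finite intersection of half-planes, one for each listed point, hence measurable.
    Testing against the points at distance e/2 from the origin on the axes bounds each coordinate by
    2/e. *)
Lemma tame_polar P : polyo P -> tame (coords (polar P)).
Proof.
move=> /polyoP[[s ->] [e [e0 eP]]]; split.
  rewrite (_ : coords _ = [set z : RT * RT | forall p, p \in s -> z.1 * 'x_0 p + z.2 * 'x_1 p <= 1]).
    elim: s {eP} => [|p s IH].
      by rewrite (_ : mkset _ = setT) //; apply/seteqP; split.
    rewrite (_ : mkset _ = [set z : RT * RT | z.1 * 'x_0 p + z.2 * 'x_1 p <= 1] `&`
        [set z : RT * RT | forall p, p \in s -> z.1 * 'x_0 p + z.2 * 'x_1 p <= 1]).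
      apply: measurableI => //.
      have mf : measurable_fun [set: RT * RT] (fun z : RT * RT => z.1 * 'x_0 p + z.2 * 'x_1 p : RT).
        by apply: measurable_funD; apply: measurable_funM.
      rewrite (_ : mkset _ = [set: RT * RT] `&`
         (fun z : RT * RT => z.1 * 'x_0 p + z.2 * 'x_1 p : RT) @^-1` `]-oo, 1]%classic).
        by apply: mf => //; exact: measurable_itv.
      by apply/seteqP; split=> z /=; rewrite in_itv /=; [split|case].
    apply/seteqP; split=> z /= => [H|[H1 H2] q].
      by split=> [|q qs]; apply: H; rewrite in_cons ?eqxx ?qs ?orbT.
    by rewrite in_cons => /orP[/eqP ->|/H2].
  by apply/seteqP; split=> z; rewrite /coords /= polar_hull pt2_x0 pt2_x1.
have e2 : `|e / 2| < e by rewrite gtr0_norm; lra.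
have e2' : `|- (e / 2)| < e by rewrite normrN.
have z0 : `|0 : R| < e by rewrite normr0.
exists (2 / e) => z; rewrite /coords /= polarE pt2_x0 pt2_x1 => H.
have bnd u : u * (e / 2) <= 1 -> u * (- (e / 2)) <= 1 -> `|u| <= 2 / e.
  by move=> h1 h2; rewrite ler_pdivlMr // -[X in _ * X](gtr0_norm e0) -normrM ler_norml; apply/andP; split; lra.
have := H _ (eP _ _ e2 z0); have := H _ (eP _ _ e2' z0).
have := H _ (eP _ _ z0 e2); have := H _ (eP _ _ z0 e2').
rewrite !pt2_x0 !pt2_x1 !mulr0 !add0r !addr0 => *.
by split; apply: bnd.
Qed.

Lemma polar_lin phi P y :
  polar ((fun x => phi *m x) @` P) y <-> polar P (phi^T *m y).
Proof.
split=> H x Px; first by rewrite trmx_mul trmxK -mulmxA; apply: H; exists x.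
by move: Px => [x' Px' <-]; have := H _ Px'; rewrite trmx_mul trmxK mulmxA.
Qed.

Definition polmom P : 'M[R]_2 := moment2 (polar P).

Definition contra_at phi := forall P, polyo P ->
  polmom ((fun x => phi *m x) @` P) = act phi (polmom P).

(** The polar of the image under [phi] is the preimage of the polar under the transpose of [phi],
    which is [F] in coordinates; so contravariance is the change of variables by [F], solved for the
    new moment matrix. *)
Lemma contra_change phi (F : RT * RT -> RT * RT) : phi \in unitmx ->
  (forall z, pt2 (F z).1 (F z).2 = phi^T *m pt2 z.1 z.2) ->
  measurable_fun setT F ->
  (forall X, measurable X -> leb2 X = (`|\det phi|%:E * leb2 (F @^-1` X))%E) ->
  contra_at phi.
Proof.
move=> u FE mF law P oP; rewrite /polmom !moment2E.
have E : coords (polar ((fun x => phi *m x) @` P)) = F @^-1` coords (polar P).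
  by apply/seteqP; split=> z; rewrite /coords /= polar_lin FE.
have tF := tame_polar (polyo_lin u oP); rewrite E in tF *.
have n0 : `|\det phi| != 0 by rewrite normr_eq0 -unitfE -unitmxE.
have ut : phi^T \in unitmx by rewrite unitmx_tr.
rewrite (mom_change FE mF (normr_ge0 _) law (tame_polar oP) tF) actZ /act scalerA divff // scale1r.
by rewrite trmxK trmx_inv !mulmxA mulVmx // mul1mx mulmxK.
Qed.

Lemma contra_swap : contra_at swapmx.
Proof.
apply: (@contra_change _ (@swapfun R)); first exact: swapmx_unit.
- move=> z; apply: pt2_eq.
    by rewrite mulmx_x0 ![(_^T)%R _ _]mxE !mx2E !pt2_x0 !pt2_x1; ring.
  by rewrite mulmx_x1 ![(_^T)%R _ _]mxE !mx2E !pt2_x0 !pt2_x1; ring.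
- exact: measurable_swapfun.
- move=> X mX; rewrite det_mx2 !mx2E mul0r mul1r sub0r normrN1.
  exact: lebesgue2_swap.
Qed.

(** Upper triangular because the change of variables is by the transpose, here [lowfun t c]. *)
Lemma contra_up t c : c != 0 -> contra_at (mx2 1 t 0 c).
Proof.
move=> c0; have dE : \det (mx2 1 t 0 c) = c by rewrite det_mx2 !mx2E mul1r mulr0 subr0.
apply: (@contra_change _ (lowfun t c)); first by rewrite unitmxE dE unitfE.
- move=> z; apply: pt2_eq.
    by rewrite mulmx_x0 ![(_^T)%R _ _]mxE !mx2E !pt2_x0 !pt2_x1; ring.
  by rewrite mulmx_x1 ![(_^T)%R _ _]mxE !mx2E !pt2_x0 !pt2_x1.
- exact: measurable_lowfun.
- by move=> X mX; rewrite dE; apply: lebesgue2_low.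
Qed.

Lemma contra_mul phi psi : phi \in unitmx -> psi \in unitmx ->
  contra_at phi -> contra_at psi -> contra_at (phi *m psi).
Proof.
move=> u v cu cv P oP; rewrite actM // -cv // -cu; last exact: polyo_lin.
congr polmom; apply/seteqP; split=> [_ [x Px <-]|_ [_ [x Px <-] <-]] /=.
  by exists (psi *m x); [exists x|rewrite mulmxA].
by exists x; rewrite // mulmxA.
Qed.

(** A triangular factorisation. Conjugating an upper triangular generator by the swap gives a lower
    triangular factor, and together with an upper one it yields every invertible matrix with
    non-zero entry (0, 0); if that entry is zero, a swap of the rows comes first. *)
Lemma contra_unit phi : phi \in unitmx -> contra_at phi.
Proof.
have gen psi : psi i0 i0 != 0 -> psi \in unitmx -> contra_at psi.
  move=> a0 u; set t := psi i0 i1 / psi i0 i0.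
  have d0 : psi i1 i1 - psi i1 i0 * t != 0.
    move: u; rewrite unitmxE det_mx2 unitfE; apply: contraNneq => d0.
    rewrite (_ : _ - _ = psi i0 i0 * (psi i1 i1 - psi i1 i0 * t)); first by rewrite d0 mulr0.
    by rewrite /t; field.
  have e : psi = swapmx *m mx2 1 (psi i1 i0) 0 (psi i0 i0) *m swapmx *m
     mx2 1 t 0 (psi i1 i1 - psi i1 i0 * t).
    by apply: mx2_eq; rewrite !mulmx2E !mx2E /t; field.
  have u1 : mx2 1 (psi i1 i0) 0 (psi i0 i0) \in unitmx.
    by rewrite unitmxE det_mx2 !mx2E unitfE mul1r mulr0 subr0.
  have u2 : mx2 1 t 0 (psi i1 i1 - psi i1 i0 * t) \in unitmx.
    by rewrite unitmxE det_mx2 !mx2E unitfE mul1r mulr0 subr0.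
  have su := @swapmx_unit R; have cs := contra_swap.
  have su1 : swapmx *m mx2 1 (psi i1 i0) 0 (psi i0 i0) \in unitmx by rewrite unitmx_mul su u1.
  have su1s : swapmx *m mx2 1 (psi i1 i0) 0 (psi i0 i0) *m swapmx \in unitmx.
    by rewrite unitmx_mul su1 su.
  rewrite e; apply: (contra_mul su1s u2 _ (@contra_up t _ d0)).
  exact: (contra_mul su1 su (contra_mul su u1 cs (@contra_up _ _ a0)) cs).
move=> u; have [a0|] := eqVneq (phi i0 i0) 0; last by move=> /gen; apply.
have su := @swapmx_unit R.
rewrite -[phi]mul1mx -swapmxK -mulmxA; apply: contra_mul => //.
- by rewrite unitmx_mul su.
- exact: contra_swap.
apply: gen; last by rewrite unitmx_mul su.
rewrite mulmx2E !mx2E mul0r mul1r add0r; apply: contraTneq u => c0.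
by rewrite unitmxE det_mx2 a0 c0 mul0r mulr0 subrr unitr0.
Qed.

(** A discrete connectedness argument: a walk covered by two sets that starts in one and ends in the
    other has a step at which it passes from the first to the second. *)
Lemma consecutive_switch (A B : nat -> Prop) n : A 0%N -> B n ->
  (forall i, (i <= n)%N -> A i \/ B i) ->
  exists i, (i <= n)%N /\ A i /\ (B i \/ (i < n)%N /\ B i.+1).
Proof.
elim: n => [|n IH] A0 Bn AB; first by exists 0%N; split=> //; split=> //; left.
have [An|Bn'] := AB n (leqnSn n).
  by exists n; split; [exact: leqnSn|split=> //; right].
have [|i [ni [Ai H]]] := IH A0 Bn'; first by move=> i ni; apply: AB; exact: leqW.
exists i; split; first exact: leqW.
split=> //; case: H => [|[? ?]]; [by left|right; split=> //; exact: ltnW].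
Qed.

(* If y exceeds 1 at x in K and at x' in L, walk from x to x' in small steps
   inside the convex set K `|` L; at the point where the walk passes from K to L, a
   slight contraction towards the origin lands in K `&` L with value still above 1. *)
Lemma polarI K L : polyo K -> polyo L -> polyo (K `|` L) ->
  polar (K `&` L) = polar K `|` polar L.
Proof.
move=> oK oL oU; apply/seteqP; split=> y; last first.
  by move=> [H x [Kx Lx]|H x [Kx Lx]]; apply: H.
move=> /polarE H; apply: contrapT => /not_orP[].
move=> nK nL.
have [x Kx yx] : exists2 x, K x & 1 < 'x_0 y * 'x_0 x + 'x_1 y * 'x_1 x.
  apply: contrapT => nx; apply: nK; apply/polarE => x Kx.
  by rewrite leNgt; apply/negP => ?; apply: nx; exists x.
have [x' Lx yx'] : exists2 x, L x & 1 < 'x_0 y * 'x_0 x + 'x_1 y * 'x_1 x.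
  apply: contrapT => nx; apply: nL; apply/polarE => x' Lx.
  by rewrite leNgt; apply/negP => ?; apply: nx; exists x'.
have cU := polyo_cvx oU; have cK := polyo_cvx oK; have cL := polyo_cvx oL.
have /polyoP[_ bK] := oK; have K0 := boxin0 bK.
have /polyoP[_ [e [e0 eL]]] := oL.
pose v (z : 'cV[R]_2) := 'x_0 y * 'x_0 z + 'x_1 y * 'x_1 z.
pose r := Num.min (v x) (v x').
have r1 : 1 < r by rewrite lt_min yx yx'.
have rx : r <= v x by rewrite ge_min lexx.
have rx' : r <= v x' by rewrite ge_min lexx orbT.
(* Chosen so that (1 - eps) r = (r + 1)/2: contracting by 1 - eps keeps the value above 1. *)
pose eps := (r - 1) / (2 * r).
have eps0 : 0 < eps by apply: divr_gt0; lra.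
have eps1 : eps < 1 by rewrite ltr_pdivrMr; lra.
have epsr : 1 < (1 - eps) * r.
  have -> : (1 - eps) * r = (r + 1) / 2 by rewrite /eps; field; rewrite gt_eqF; lra.
  lra.
pose d0 := 'x_0 x - 'x_0 x'; pose d1 := 'x_1 x - 'x_1 x'.
pose M := 1 + `|d0| + `|d1|.
have nd0 := normr_ge0 d0; have nd1 := normr_ge0 d1.
have [n Hn] : exists n : nat, M / (eps * e) < n.+1%:R.
  exists (Num.bound (M / (eps * e))); apply: lt_trans (archi_boundP _) _.
    by apply: divr_ge0; [rewrite /M; lra|apply: mulr_ge0; lra].
  by rewrite ltr_nat.
have n0 : 0 < n.+1%:R :> R by rewrite ltr0n.
have n0n : n.+1%:R != 0 :> R by rewrite gt_eqF.
pose w (i : nat) : 'cV[R]_2 := (1 - i%:R / n.+1%:R) *: x + (1 - (1 - i%:R / n.+1%:R)) *: x'.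
have in01 (i : nat) : (i <= n.+1)%N -> 0 <= (1 - i%:R / n.+1%:R : R) /\ (1 - i%:R / n.+1%:R : R) <= 1.
  move=> ni; have h1 : i%:R / n.+1%:R <= 1 :> R by rewrite ler_pdivrMr // mul1r ler_nat.
  have h0 : 0 <= i%:R / n.+1%:R :> R by apply: divr_ge0.
  by split; [rewrite subr_ge0|rewrite lerBlDr lerDl].
have [|||i [ni [Kw Lw]]] := @consecutive_switch (fun i => K (w i)) (fun i => L (w i)) n.+1.
- by rewrite /w mul0r subr0 subrr scale1r scale0r addr0.
- by rewrite /w divff // subrr subr0 scale0r scale1r add0r.
- move=> i ni; have [h0 h1] := in01 _ ni.
  by apply: (cU x x' _ _ _ h0 h1); [left|right].
have [t0 t1] := in01 _ ni.
have vw : r <= v (w i).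
  have -> : v (w i) = (1 - i%:R / n.+1%:R) * v x + (1 - (1 - i%:R / n.+1%:R)) * v x'.
    by rewrite /v /w !mxE; ring.
  by move: (1 - i%:R / n.+1%:R) t0 t1 => t t0 t1; nra.
pose z := (1 - eps) *: w i.
have Kz : K z.
  have := cK (w i) 0 (1 - eps) Kw K0; rewrite scaler0 addr0; apply; lra.
have vz : 1 < v z.
  have -> : v z = (1 - eps) * v (w i) by rewrite /v /z !mxE; ring.
  nra.
have Lz : L z.
  case: Lw => [Lw|[lin Lw]].
    have := cL (w i) 0 (1 - eps) Lw (boxin0 (ex_intro _ e (conj e0 eL))).
    by rewrite scaler0 addr0; apply; lra.
  (* One step of the walk is (x - x')/(n + 1). So [z] is the contracted point [w i.+1] plus (1 -
     eps) times this step, which equals [eps] times the point k (x - x'). The choice of [n] puts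
     that point into the square around the origin contained in [L]. *)
  pose k := (1 - eps) / (eps * n.+1%:R).
  have -> : z = (1 - eps) *: w i.+1 + (1 - (1 - eps)) *: pt2 (k * d0) (k * d1).
    by apply: pt2_eq; rewrite /z /w !mxE /= /k /d0 /d1 -natr1; field;
      rewrite natr1 n0n gt_eqF.
  have kM : k * M < e.
    rewrite mulrAC ltr_pdivrMr; last exact: mulr_gt0.
    move: Hn; rewrite ltr_pdivrMr; last exact: mulr_gt0.
    have M0 : 0 < M by rewrite /M; lra.
    nra.
  have k0 : 0 < k by apply: divr_gt0; [lra|exact: mulr_gt0].
  apply: cL => //; [|lra|lra].
  by apply: eL; rewrite normrM (gtr0_norm k0); apply: le_lt_trans kM;
    rewrite ler_pM2l // /M; lra.
by have := H z (conj Kz Lz); rewrite -/(v z); lra.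
Qed.

Lemma polarU K L : polar (K `|` L) = polar K `&` polar L.
Proof.
apply/seteqP; split=> y; first by move=> H; split=> x Px; apply: H; [left|right].
by move=> [H1 H2] x [/H1|/H2].
Qed.

(** Polarity exchanges union and intersection here, so the claim becomes additivity of the integral:
    with [A] and [B] the two polars, both the union of [A] and [B] and the set [B] itself are split
    off along [B] minus [A]. *)
Lemma polmom_valuation : valuation_on_polyo polmom.
Proof.
move=> K L oK oL oU oI; rewrite /polmom polarU polarI // !moment2E.
have [mK _] := tame_polar oK; have [mL _] := tame_polar oL.
have tU : tame (coords (polar K `|` polar L)) by rewrite -polarI //; apply: tame_polar.
apply/matrixP => i j; rewrite ![in LHS]mxE ![in RHS]mxE.
set A := coords (polar K); set B := coords (polar L).
have -> : coords (polar K `&` polar L) = A `&` B by [].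
have UE : coords (polar K `|` polar L) = A `|` (B `\` A).
  apply/seteqP; split=> z; last by move=> [zA|[zB _]]; [left|right].
  by move=> [zA|zB]; [left|have [zA|nA] := pselect (A z); [left|right]].
have BE : (A `&` B) `|` (B `\` A) = B.
  apply/seteqP; split=> z; first by move=> [[_ zB]|[zB _]].
  by move=> zB; have [zA|nA] := pselect (A z); [left|right].
have mD : measurable (B `\` A) by apply: measurableD.
have mI : measurable (A `&` B) by apply: measurableI.
have dis1 : [disjoint A & B `\` A] by apply/disj_setPS => z /= [zA [_]].
have dis2 : [disjoint A `&` B & B `\` A] by apply/disj_setPS => z /= [[zA _] [_]].
have E1 := Rintegral_setU mK mD (f := mono i j) _ dis1; rewrite -UE in E1.
have E2 := Rintegral_setU mI mD (f := mono i j) _ dis2; rewrite BE in E2.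
rewrite E1; last exact: mono_integrable.
rewrite [in RHS]E2; last by apply: mono_integrable; apply: tame_polar.
exact: addrCA.
Qed.

Lemma polmom_square_gt0 : 0 < polmom (trap (- 1) 1 1 0 (- 1) 0) i0 i0.
Proof.
set Q := trap _ _ _ _ _ _.
have oQ : polyo Q by apply: trap_polyo; split=> //; try lra; split; lra.
have tQ := tame_polar oQ.
have int := mono_integrable i0 i0 tQ.
rewrite /polmom moment2E mxE.
(* The polar of the square is given by |y_0| + |y_1| <= 1. It contains this rectangle, on which
   y_0^2 >= 1/16. *)
pose B : set (RT * RT) := `[1 / 4, 1 / 2]%classic `*` `[0, 1 / 4]%classic.
have mB : measurable B by apply: measurableX; exact: measurable_itv.
have BQ : B `<=` coords (polar Q).
  move=> z [] /=; rewrite !in_itv /= => /andP[? ?] /andP[? ?].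
  rewrite /coords /= polarE !pt2_x0 !pt2_x1 => x [? ? ? ?]; nra.
have mono0 z : 0 <= mono i0 i0 z by rewrite /mono -expr2 sqr_ge0.
apply: (@lt_le_trans _ _ (fine ((1 / 16)%:E * leb2 B)%E)).
  rewrite /lebesgue2 product_measure1E; [|exact: measurable_itv..].
  rewrite /= !lebesgue_measure_itv /= !lte_fin.
  rewrite !ifT; try lra.
  by rewrite -!EFinB -!EFinM /=; lra.
apply: fine_le.
- rewrite fin_numM // ge0_fin_numE // tame_finite //; split=> //.
  by exists 1 => z [] /=; rewrite !in_itv /= => /andP[? ?] /andP[? ?]; split; rewrite ler_norml; apply/andP; split; lra.
- exact: (integrable_fin_num tQ.1 int).
apply: (@le_trans _ _ (\int[leb2]_(z in B) (mono i0 i0 z)%:E)%E).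
  rewrite -integral_cst //; apply: ge0_le_integral => //.
  - by move=> z _; rewrite lee_fin; lra.
  - by apply/measurable_EFinP; exact: measurable_mono.
  - move=> z [z1 _]; move: z1; rewrite /= in_itv /= => /andP[? ?].
    by rewrite lee_fin /mono pt2_x0; nra.
apply: ge0_subset_integral => //; first exact: tQ.1.
  by apply/measurable_EFinP; exact: measurable_mono.
by move=> z _; rewrite lee_fin; exact: mono0.
Qed.

End PolarMoments.

(** * Uniqueness up to a constant, and the conclusion *)

Lemma uniqueness (R : realType) (mu : set 'cV[R]_2 -> 'M[R]_2) :
  valuation_on_polyo mu -> GL2_contravariant mu ->
  mu (trap (- 1) 1 1 0 (- 1) 0) ord0 ord0 = 0 -> forall P, polyo P -> mu P = 0.
Proof.
move=> mu_val mu_con mu0; apply: polyo_zero => //.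
exact: trap_zero.
Qed.

Unset Implicit Arguments.

Theorem theorem3p13 (R : realType) (mu : set 'cV[R]_2 -> 'M[R]_2) :
  measurable_on_polyo mu -> valuation_on_polyo mu -> GL2_contravariant mu ->
  exists k : R, forall P, @polyo R P -> mu P = k *: moment2 (polar P).
Proof.
move=> _ mu_val mu_con.
pose Q : set 'cV[R]_2 := trap (- 1) 1 1 0 (- 1) 0.
pose k := mu Q ord0 ord0 / polmom Q ord0 ord0; exists k => P oP.
apply/eqP; rewrite -subr_eq0; apply/eqP.
apply: (@uniqueness R (fun P => mu P - k *: polmom P)) oP.
- move=> K L oK oL oU oI.
  rewrite addrACA -opprD -scalerDr mu_val // polmom_valuation //.
  by rewrite scalerDr opprD addrACA.
- move=> phi K u oK; rewrite mu_con // (contra_unit u) //.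
  by rewrite -/(act phi (mu K)) -/(act phi _) actD actN actZ.
- have entryE (A B : 'M[R]_2) c : (A - c *: B) ord0 ord0 = A ord0 ord0 - c * B ord0 ord0.
    by rewrite !mxE.
  by rewrite entryE divfK ?subrr // gt_eqF // polmom_square_gt0.
Qed.
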